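(* Let $B\in\mathbb Z_{\ge1}$, suppose $\mu\prec B$, let $t>0$ and let $i\ge1$ be an integer. Then, for $z\ge0$, $$P\Big(S_t^{(i)}-\mathbb E[S_t^{(i)}]\le -z\Big)\le\exp\left(-\frac{z^2}{2((B-1)i+1)\,\mathbb E[S_t^{(i)}]}\right),$$ $$P\Big(S_t^{(i)}-\mathbb E[S_t^{(i)}]\ge z\Big)\le\exp\left(-\frac{z^2}{2((B-1)i+1)\big(\mathbb E[S_t^{(i)}]+\frac z3\big)}\right).$$
   Context: $\mathcal{S}$ is an at most countable set of species and $\mu$ is a probability measure on $2^{\mathcal S}$ supported on finite sets; $\mu\prec B$ means $\mu(A)=0$ whenever $|A|>B$. Let $X_1,X_2,\dots$ be i.i.d. from $\mu$ and $n\sim\mathrm{Poisson}(t)$ independent of the $X_j$. For $s\in\mathcal S$, $N_s=|\{j\le n: s\in X_j\}|$. For $j\ge1$, $\phi_j=|\{s:N_s=j\}|$, and $S_t^{(i)}=\sum_{j=i}^\infty\phi_j=|\{s:N_s\ge i\}|$ is the number of species seen at least $i$ times. *)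

(* Defs.v *)
From mathcomp Require Import all_boot all_order all_algebra finmap.
From mathcomp Require Import all_classical all_reals all_analysis.

Set Implicit Arguments.
Unset Strict Implicit.
Unset Printing Implicit Defensive.

Import Order.TTheory GRing.Theory Num.Theory.

Local Open Scope classical_set_scope.
Local Open Scope ring_scope.

(* 2^S with its product sigma-algebra, generated by the coordinate events
   {A | s \in A}.  For countable S, singletons and the set of finite subsets
   are measurable. *)
Definition coordinate_events (S : Type) : set (set (set S)) :=
  range (fun s : S => [set A : set S | A s]).
Arguments coordinate_events : clear implicits.

Notation powersetType S := (g_sigma_algebraType (coordinate_events S)).

Definition supported_on_finite_sets (R : realType) (S : countType)
    (mu : probability (powersetType S) R) : Prop :=
  mu [set A : set S | finite_set A] = 1%E.

(* mu \prec B; [counting A] is the cardinality of A, +oo if A is infinite *)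
Definition size_bounded (R : realType) (S : countType)
    (mu : probability (powersetType S) R) (B : nat) : Prop :=
  forall A : set S, (B%:R%:E < counting A :> \bar R)%E -> mu [set A] = 0%E.

Definition mutually_independent d (T : measurableType d) (R : realType)
    (P : probability T R) (I : choiceType) (F : I -> set (set T)) : Prop :=
  forall (J : {fset I}) (E : I -> set T),
    (forall i, i \in J -> F i (E i)) ->
    P (\bigcap_(i in [set` J]) E i) = (\prod_(i <- J) P (E i))%E.

(* The family of sigma-algebras generated by n (index None) and by the X_j
   (indices Some j) *)
Definition sample_sigma_algebras d (T : measurableType d) (S : countType)
    (n : T -> nat) (X : nat -> T -> powersetType S) (o : option nat) :
    set (set T) :=
  match o with
  | None => preimage_set_system setT n measurable
  | Some j => preimage_set_system setT (X j) measurable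
  end.

(* X_1, X_2, ... i.i.d. from mu, n Poisson with mean t and independent of them;
   samples are numbered from 0, so that X j is the (j+1)-st one.  The laws are
   only compared on measurable sets since measures are arbitrary elsewhere. *)
Definition poissonized_sampling d (T : measurableType d) (R : realType)
    (P : probability T R) (S : countType)
    (mu : probability (powersetType S) R) (t : R)
    (n : {RV P >-> nat}) (X : nat -> {RV P >-> powersetType S}) : Prop :=
  [/\ forall k : nat, distribution P n [set k] = (poisson_pmf t k)%:E,
      forall j (A : set (powersetType S)), measurable A ->
        distribution P (X j) A = mu A
    & mutually_independent P (sample_sigma_algebras n X)].

Section species_counts.
Context (T : Type) (S : countType) (n : T -> nat) (X : nat -> T -> set S).

(* N_s *)
Definition occurrences (s : S) (w : T) : nat :=
  #|[pred j : 'I_(n w) | `[< X j w s >] ]|.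

(* phi_j *)
Definition prevalence (R : realType) (j : nat) (w : T) : \bar R :=
  counting [set s | occurrences s w = j].

(* S_t^{(i)}; a priori +oo when infinitely many species are seen, which has
   probability 0 when the sampled sets are almost surely finite *)
Definition seen_at_least (R : realType) (i : nat) (w : T) : \bar R :=
  counting [set s | (i <= occurrences s w)%N].

Lemma counting_esum (R : realType) (A : set S) :
  counting A = (\esum_(s in A) 1)%E :> \bar R.
Proof.
rewrite /counting; case: ifPn => /asboolP finA.
  rewrite esum_fset// fsbig_finite//= sumEFin; congr (_%:E).
  by rewrite card_fset_sum1 natr_sum.
apply/esym/eqyP => r r0.
have [B BA cardB] := infinite_set_fset (Num.bound r) finA.
apply: esum_ge; exists [set` B]; first by split.
rewrite fsbig_finite//= set_fsetK sumEFin lee_fin.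
have := card_fset_sum1 B; move/(congr1 (fun m => m%:R : R)); rewrite natr_sum => <-.
apply/ltW/(lt_le_trans (archi_boundP (ltW r0))).
by rewrite ler_nat.
Qed.

Lemma seen_at_leastE (R : realType) (i : nat) (w : T) :
  seen_at_least R i w = (\sum_(i <= j <oo) prevalence R j w)%E.
Proof.
rewrite /seen_at_least.
have -> : [set s | (i <= occurrences s w)%N] =
    \bigcup_(j in [set j | (i <= j)%N]) [set s | occurrences s w = j].
  apply/seteqP; split=> [s /= h|s [j /= ij sj]]; last by rewrite sj.
  by exists (occurrences s w).
rewrite counting_esum esum_bigcupT//; last first.
  by move=> j k _ _ [s [/= ej ek]]; rewrite -ej -ek.
rewrite -(@nneseries_esum _ _ (fun j => (i <= j)%N)); last first.
  by move=> j _; exact: esum_ge0.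
rewrite [RHS]eseries_cond; apply: congr_lim.
by apply/funext => m; apply: eq_bigr => j _; rewrite -counting_esum.
Qed.

End species_counts.

(* Main.v *)
Require Import Defs.
From mathcomp Require Import all_boot all_order all_algebra finmap.
From mathcomp Require Import all_classical all_reals all_analysis.
From mathcomp Require Import measurable_realfun ring lra.

(** Write S for the number of species seen at least i times, N_s for the number
of samples containing s, and c = (B - 1) i + 1. The bounds come from a size-bias
argument, carried out on the moment generating function m(theta) = E[e^(theta S)]
of the number S of species of a finite list F that are seen at least i times:
[[
  m'(theta) = E[S e^(theta S)] = sum_(s in F) E[1_(N_s >= i) e^(theta S)].
]]
Each summand asks how much conditioning on N_s >= i can move S. Poissonization
makes the samples containing s a Poisson number of i.i.d. sets, independent of
the other samples, and conditioning that Poisson number to be at least i adds at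
most i samples to it. Each added sample reveals at most B - 1 species besides s,
and s itself counts once, so S grows by at most c. For theta >= 0 this reads
[[
  E[1_(N_s >= i) e^(theta S)] <= P(N_s >= i) e^(c theta) m(theta),
]]
and the inequality is reversed for theta <= 0 ([size_bias_species]). Summing over
s yields m' <= E[S] e^(c theta) m on the right of 0 and the reverse inequality on
its left, and integrating from 0 gives on both sides
[[
  m(theta) <= exp (E[S] (e^(c theta) - 1) / c),
]]
the moment generating function of c times a Poisson variable of mean E[S] / c
([species_mgf_le]). Chernoff's method and e^u - 1 - u <= (u^2 / 2) / (1 - u / 3)
for 0 <= u < 3, respectively e^u <= 1 + u + u^2 / 2 for u <= 0, then produce the
two exponents.

The conditioning step is done without constructing a coupling. Let a_k be the
mean on the level N_s = k of the exponential G of theta times the number of other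
species seen. The Mecke equation ([campbell_mecke]) expresses (k + 1) a_(k+1)
through the mean on the level k of G with one sample added, hence as a_k times
the intensity of samples containing s and a factor between 1 and
beta = e^(theta (B - 1)). Dividing by the Poisson probabilities p_k of the levels
gives conditional means g_k that are monotone in k and change by at most a
factor beta from each level to the next; since p_(k+i) / p_k is nonincreasing in
k, the Chebyshev sum inequality bounds the sum of p_(k+i) g_(k+i) by beta^i times
P(N_s >= i) times the sum of p_k g_k ([poisson_conditioning],
[tail_conditioning]).

All of this happens on the countable space of finite sequences of finite sets
of species, where expectations are sums against the explicit weights of the
Poissonized sample; [prob_of_configurations] transports the estimates to P.
Working with finite lists of species makes m a finite sum of exponentials, and
the bounds pass to all species by exhausting S. *)

Import Order.TTheory GRing.Theory Num.Theory.
Import numFieldNormedType.Exports.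
Local Open Scope classical_set_scope.
Local Open Scope ring_scope.

Set Implicit Arguments.
Unset Strict Implicit.
Unset Printing Implicit Defensive.

(** * Exponential inequalities *)

Section exponential_inequalities.
Context {R : realType}.
Implicit Types (u x M c z theta : R).

Lemma is_derive_ge0_le (f f' : R -> R) (a b : R) : a <= b ->
  (forall x : R, is_derive x 1 f (f' x)) ->
  (forall x : R, a < x < b -> 0 <= f' x) -> f a <= f b.
Proof.
rewrite le_eqVlt => /predU1P[->//|ab] df f'0.
have cf : {within `[a, b], continuous f}.
  apply: continuous_subspaceT => x.
  by apply: differentiable_continuous; apply/derivable1_diffP; case: (df x).
have [x + fab] := MVT ab (fun x _ => df x) cf.
rewrite in_itv/= -subr_ge0 fab => xab.
by rewrite mulr_ge0 ?f'0// subr_ge0 ltW.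
Qed.

Lemma expR_le_quadratic u : u <= 0 -> expR u <= 1 + u + u ^+ 2 / 2.
Proof.
move=> u0.
have := @is_derive_ge0_le (fun v => expR v - (1 + v + v ^+ 2 / 2))
  (fun v => expR v - (1 + v)) u 0 u0.
rewrite expR0 expr0n mul0r !addr0 subrr subr_le0; apply.
- move=> v; apply: is_derive_eq.
  by rewrite /GRing.scale/=; lra.
- by move=> v _; rewrite subr_ge0 expR_ge1Dx.
Qed.

(** Termwise, u^k / k! <= (u^2 / 2) (u / 3)^(k - 2); differentiating twice
replaces the geometric series by the single inequality 1 - u <= exp(- u). *)
Lemma expR_le_geometric u : 0 <= u ->
  (1 - u / 3) * (expR u - 1 - u) <= u ^+ 2 / 2.
Proof.
move=> u0.
have slope_ge0 (v : R) : 0 <= v -> 0 <= (v + 2 + (v - 2) * expR v) / 3.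
  move=> v0.
  have := @is_derive_ge0_le (fun v => (v + 2 + (v - 2) * expR v) / 3)
    (fun v => (1 + (v - 1) * expR v) / 3) 0 v v0.
  rewrite expR0 (_ : (0 + 2 + (0 - 2) * 1) / 3 = 0 :> R); last by lra.
  apply.
  - by move=> x; apply: is_derive_eq; rewrite /GRing.scale/=; lra.
  - move=> x _; rewrite divr_ge0//.
    have := ler_wpM2r (expR_ge0 x) (expR_ge1Dx (- x)).
    by rewrite -expRD addNr expR0 => ?; lra.
have := @is_derive_ge0_le
  (fun v => v ^+ 2 / 2 - (1 - v / 3) * (expR v - 1 - v))
  (fun v => (v + 2 + (v - 2) * expR v) / 3) 0 u u0.
rewrite expR0 expr0n (_ : _ - _ = 0 :> R); last by rewrite /=; lra.
rewrite subr_ge0; apply.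
- by move=> x; apply: is_derive_eq; rewrite /GRing.scale/=; lra.
- by move=> x /andP[/ltW x0 _]; exact: slope_ge0.
Qed.

(** The quotient of m by the claimed bound equals 1 at 0, is nonincreasing to the
right of 0 and nondecreasing to its left. *)
Lemma gronwall_le (m m' : R -> R) M c : c != 0 ->
  (forall x : R, is_derive x 1 m (m' x)) -> m 0 = 1 ->
  (forall theta, 0 <= theta -> m' theta <= M * expR (c * theta) * m theta) ->
  (forall theta, theta <= 0 -> M * expR (c * theta) * m theta <= m' theta) ->
  forall theta, m theta <= expR (M * ((expR (c * theta) - 1) / c)).
Proof.
move=> c0 dm m0 up down theta.
pose phi x := m x * expR (- (M * ((expR (c * x) - 1) / c))).
pose phi' x := (m' x - M * expR (c * x) * m x) *
  expR (- (M * ((expR (c * x) - 1) / c))).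
have dphi x : is_derive x 1 phi (phi' x).
  apply: is_derive_eq.
  by rewrite /phi' /GRing.scale/=; field.
have phi0 : phi 0 = 1.
  by rewrite /phi m0 mulr0 expR0 subrr mul0r mulr0 oppr0 expR0 mulr1.
suff : phi theta <= 1.
  by rewrite /phi expRN ler_pdivrMr ?expR_gt0// mul1r.
rewrite -phi0; have [t0|/ltW t0] := leP theta 0.
- apply: is_derive_ge0_le t0 dphi _ => x /andP[_ /ltW x0].
  by rewrite mulr_ge0 ?expR_ge0// subr_ge0 down.
- rewrite -lerN2.
  have dN x : is_derive x 1 (\- phi) (- phi' x) by apply: is_deriveN.
  apply: is_derive_ge0_le t0 dN _ => x /andP[/ltW x0 _].
  by rewrite -mulNr mulr_ge0 ?expR_ge0// opprB subr_ge0 up.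
Qed.

(** With u = c theta the left-hand side is (M (e^u - 1 - u) - u z) / c; taking
u = z / D for D = M + z / 3 makes 1 - u / 3 equal to M / D, so that the bound on
e^u - 1 - u turns M (e^u - 1 - u) into D u^2 / 2. *)
Lemma poisson_chernoff_upper M c z : 0 <= M -> 0 < c -> 0 <= z ->
  exists2 theta, 0 <= theta &
    M * ((expR (c * theta) - 1) / c) - theta * (M + z) <=
    - (z ^+ 2 / (2 * c * (M + z / 3))).
Proof.
move=> M0 c0 z0; set D := M + z / 3.
have D0 : 0 <= D by rewrite addr_ge0 ?divr_ge0.
have [D00|Dn0] := eqVneq D 0.
  (* D = 0 forces z = 0, and the right-hand side is then 0 *)
  exists 0 => //; rewrite mulr0 expR0 subrr mul0r mulr0 mul0r subr0.
  by rewrite D00 mulr0 invr0 mulr0 oppr0.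
have Dgt0 : 0 < D by rewrite lt0r Dn0.
set u := z / D; have u0 : 0 <= u by rewrite divr_ge0.
exists (u / c); first by rewrite divr_ge0// ltW.
rewrite (mulrCA c) divff ?gt_eqF// mulr1.
have uD : u * D = z by rewrite divfK.
have Mu : M = D * (1 - u / 3) by rewrite mulrBr mulr1 mulrCA mulrA uD /D; lra.
have H : M * (expR u - 1 - u) <= D * (u ^+ 2 / 2).
  by rewrite Mu -mulrA ler_wpM2l// expR_le_geometric.
have -> : M * ((expR u - 1) / c) - u / c * (M + z) =
    (M * (expR u - 1 - u) - u * z) / c.
  by field; rewrite gt_eqF.
have -> : - (z ^+ 2 / (2 * c * D)) = (D * (u ^+ 2 / 2) - u * z) / c.
  by rewrite -uD; field; rewrite !gt_eqF.
by rewrite ler_pM2r ?invr_gt0// lerD2r.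
Qed.

(** With u = c theta the quadratic upper bound of (M (e^u - 1 - u) + u z) / c
is minimal at u = - z / M. *)
Lemma poisson_chernoff_lower M c z : 0 < M -> 0 < c -> 0 <= z ->
  exists2 theta, theta <= 0 &
    M * ((expR (c * theta) - 1) / c) - theta * (M - z) <=
    - (z ^+ 2 / (2 * c * M)).
Proof.
move=> M0 c0 z0; set u := - (z / M).
have u0 : u <= 0 by rewrite oppr_le0 divr_ge0// ltW.
exists (u / c); first by rewrite mulr_le0_ge0// invr_ge0 ltW.
rewrite (mulrCA c) divff ?gt_eqF// mulr1.
have uM : u * M = - z by rewrite mulNr divfK ?gt_eqF.
have := expR_le_quadratic u0 => /(ler_wpM2l (ltW M0)) H.
have -> : M * ((expR u - 1) / c) - u / c * (M - z) =
    (M * expR u - M * (1 + u) + u * z) / c.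
  by field; rewrite gt_eqF.
have -> : - (z ^+ 2 / (2 * c * M)) =
    (M * (1 + u + u ^+ 2 / 2) - M * (1 + u) + u * z) / c.
  have -> : z = - (u * M) by rewrite uM opprK.
  by field; rewrite !gt_eqF.
by rewrite ler_pM2r ?invr_gt0// !lerD2r.
Qed.

End exponential_inequalities.

(** * Unordered sums and the Chebyshev sum inequality *)

Section esum_complements.
Context {R : realType}.
Local Open Scope ereal_scope.

Lemma esumZl (I : choiceType) (D : set I) (a : I -> \bar R) (c : R) :
  (0 <= c)%R -> (forall i, 0 <= a i) ->
  \esum_(i in D) (c%:E * a i) = c%:E * \esum_(i in D) a i.
Proof.
move=> c0 a0; rewrite /esum -ereal_supZl//; last first.
  by apply/set0P; exists (\sum_(i \in set0) a i), set0 => //; exact: fsets_set0.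
rewrite image_comp; congr ereal_sup; apply: eq_imagel => F _ /=.
by rewrite ge0_mule_fsumr.
Qed.

Lemma esum_exchange (I J : choiceType) (a : I -> J -> \bar R) :
  (forall i j, 0 <= a i j) ->
  \esum_(i in setT) \esum_(j in setT) a i j =
  \esum_(j in setT) \esum_(i in setT) a i j.
Proof.
move=> a0; rewrite !esum_esum//.
rewrite (reindex_esum (setT `*`` (fun=> setT)) _ (fun x : J * I => (x.2, x.1)))//.
split=> //= [[i j] [i' j'] _ _ [-> ->]//|[i j] _].
by exists (j, i).
Qed.

Lemma esum_natS (a : nat -> \bar R) : (forall k, 0 <= a k) ->
  \esum_(k in setT) a k = a 0%N + \esum_(k in setT) a k.+1.
Proof.
move=> a0; rewrite (esumID [set 0%N])// !setTI esum_set1//; congr (_ + _).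
apply: reindex_esum; split=> [//|k l _ _ []//|[|k]//= _].
by exists k.
Qed.

Lemma esum_mulr (I J : choiceType) (a : I -> R) (b : J -> R) :
  (forall i, 0 <= a i)%R -> (forall j, 0 <= b j)%R ->
  \esum_(j in setT) (b j)%:E < +oo ->
  \esum_(i in setT) \esum_(j in setT) (a i * b j)%:E =
  (\esum_(i in setT) (a i)%:E) * (\esum_(j in setT) (b j)%:E).
Proof.
move=> a0 b0 bfin; have b0' : 0 <= \esum_(j in setT) (b j)%:E.
  by apply: esum_ge0 => j _; rewrite lee_fin.
rewrite -(fineK (x := \esum_(j in setT) (b j)%:E)) ?ge0_fin_numE//.
rewrite muleC -esumZl ?fine_ge0//; apply: eq_esum => i _.
rewrite fineK ?ge0_fin_numE// muleC -esumZl//.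
Qed.

Lemma esum_esumD (I J : choiceType) (a b : I -> J -> \bar R) :
  (forall i j, 0 <= a i j) -> (forall i j, 0 <= b i j) ->
  \esum_(i in setT) \esum_(j in setT) (a i j + b i j) =
  \esum_(i in setT) \esum_(j in setT) a i j +
  \esum_(i in setT) \esum_(j in setT) b i j.
Proof.
move=> a0 b0; rewrite -esumD => [|i _|i _]; try exact: esum_ge0.
by apply: eq_esum => i _; rewrite esumD.
Qed.

(** Integrating the termwise sign condition against the product of the weights
with themselves gives both inequalities between E[f g] and E[f] E[g]. *)
Lemma chebyshev_sum (I : choiceType) (p f g : I -> R) :
  (forall k, 0 <= p k)%R -> (forall k, 0 <= f k)%R -> (forall k, 0 <= g k)%R ->
  \esum_(k in setT) (p k)%:E = 1 ->
  \esum_(k in setT) (p k * g k)%:E < +oo ->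
  let Efg := \esum_(k in setT) (p k * (f k * g k))%:E in
  let EfEg := (\esum_(k in setT) (p k * f k)%:E) *
              (\esum_(k in setT) (p k * g k)%:E) in
  ((forall k l, (f k - f l) * (g k - g l) <= 0)%R -> Efg <= EfEg) /\
  ((forall k l, 0 <= (f k - f l) * (g k - g l))%R -> EfEg <= Efg).
Proof.
move=> p0 f0 g0 p1 gfin Efg EfEg.
have sum2 (a b c d : I -> R) (h : I -> I -> R) :
    (forall k, 0 <= a k)%R -> (forall k, 0 <= b k)%R ->
    (forall k, 0 <= c k)%R -> (forall k, 0 <= d k)%R ->
    \esum_(k in setT) (b k)%:E < +oo -> \esum_(k in setT) (d k)%:E < +oo ->
    (forall k l, h k l = a k * b l + c l * d k)%R ->
    \esum_(k in setT) \esum_(l in setT) (h k l)%:E =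
    (\esum_(k in setT) (a k)%:E) * (\esum_(k in setT) (b k)%:E) +
    (\esum_(k in setT) (c k)%:E) * (\esum_(k in setT) (d k)%:E).
  move=> a0 b0 c0 d0 bfin dfin hE; rewrite -!esum_mulr//.
  rewrite [X in _ = _ + X]esum_exchange => [|k l]; last first.
    by rewrite lee_fin mulr_ge0.
  rewrite -esum_esumD => [|k l|k l]; try by rewrite lee_fin mulr_ge0.
  by apply: eq_esum => k _; apply: eq_esum => l _; rewrite hE.
have EfgD : Efg + Efg = \esum_(k in setT) \esum_(l in setT)
    (p k * p l * (f k * g k + f l * g l))%:E.
  rewrite (sum2 (fun k => p k * (f k * g k))%R p
                (fun k => p k * (f k * g k))%R p) => [|||||||k l]//.
  - by rewrite p1 mule1.
  - by move=> k; rewrite !mulr_ge0.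
  - by move=> k; rewrite !mulr_ge0.
  - by rewrite p1 ltry.
  - by rewrite p1 ltry.
  - by ring.
have EfEgD : EfEg + EfEg = \esum_(k in setT) \esum_(l in setT)
    (p k * p l * (f k * g l + f l * g k))%:E.
  rewrite (sum2 (fun k => p k * f k)%R (fun k => p k * g k)%R
                (fun k => p k * f k)%R (fun k => p k * g k)%R) => [|||||||k l]//.
  - by move=> k; rewrite mulr_ge0.
  - by move=> k; rewrite mulr_ge0.
  - by move=> k; rewrite mulr_ge0.
  - by move=> k; rewrite mulr_ge0.
  - by ring.
have half (x y : \bar R) : x + x <= y + y -> x <= y.
  by rewrite !leNgt; apply: contra => yx; exact: lteD.
split=> fg; apply: half; rewrite EfgD EfEgD; apply: le_esum => k _;
  apply: le_esum => l _; rewrite lee_fin ler_wpM2l ?mulr_ge0//;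
  by have := fg k l; lra.
Qed.

End esum_complements.

(** * Conditioning a Poisson variable to be at least i *)

Section poisson_shift.
Context {R : realType}.
Local Open Scope ereal_scope.

(** The recurrence makes p the Poisson probabilities of mean lambda, and a k is to
be read as p k times a conditional mean g k. The hypotheses on a say that g is
monotone and that consecutive values differ by a factor between 1 and beta, so
that g (k + i) is comparable to beta ^ i g k; as p (k + i) / p k is nonincreasing
in k, what remains is an instance of the Chebyshev sum inequality. *)
Lemma poisson_conditioning (p a : nat -> R) (lambda beta : R) (i : nat) :
  (0 <= lambda)%R -> (0 <= beta)%R -> (0 < i)%N ->
  (forall k, 0 <= p k)%R -> (forall k, 0 <= a k)%R ->
  (forall k, k.+1%:R * p k.+1 = lambda * p k)%R ->
  \esum_(k in setT) (p k)%:E = 1 -> \esum_(k in setT) (a k)%:E < +oo ->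
  let tail := \esum_(k in setT) (a (k + i)%N)%:E in
  let bound := (beta ^+ i)%:E * ((\esum_(k in setT) (p (k + i)%N)%:E) *
                                 (\esum_(k in setT) (a k)%:E)) in
  ((forall k, lambda * a k <= k.+1%:R * a k.+1 <= beta * (lambda * a k))%R ->
     tail <= bound) /\
  ((forall k, beta * (lambda * a k) <= k.+1%:R * a k.+1 <= lambda * a k)%R ->
     bound <= tail).
Proof.
move=> l0 b0 i0 p0 a0 pS p1 afin tail bound.
have [lam0|lam_neq0] := eqVneq lambda 0%R.
  have vanish (b : nat -> R) : (forall k, k.+1%:R * b k.+1 = 0)%R ->
      \esum_(k in setT) (b (k + i)%N)%:E = 0.
    move=> bS; apply: esum1 => k _; rewrite -(prednK i0) addnS.
    by have /eqP := bS (k + i.-1)%N; rewrite mulf_eq0 pnatr_eq0/= => /eqP ->.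
  have -> : bound = 0.
    rewrite /bound vanish ?mul0e ?mule0// => k.
    by rewrite pS lam0 mul0r.
  split=> aS; rewrite /tail vanish// => k; have := aS k;
    by rewrite lam0 mul0r mulr0 => /le_anti.
(* For lambda > 0 all p k are positive, which allows dividing by them. *)
have lgt0 : (0 < lambda)%R by rewrite lt0r lam_neq0.
have pgt0 k : (0 < p k)%R.
  have p00 : (0 < p 0%N)%R.
    rewrite lt0r p0 andbT; apply/eqP => p00.
    have p_eq0 : forall j, p j = 0%R.
      elim=> // j IH; have /eqP := pS j; rewrite IH mulr0 mulf_eq0 pnatr_eq0/=.
      by move/eqP.
    have : \esum_(k in setT) (p k)%:E = 0 by apply: esum1 => j _; rewrite p_eq0.
    by rewrite p1 => /eqP; rewrite onee_eq0.
  elim: k => // k IH; have : (0 < k.+1%:R * p k.+1)%R by rewrite pS mulr_gt0.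
  by rewrite pmulr_rgt0.
have pS' k : p k.+1 = (lambda * p k / k.+1%:R)%R.
  by rewrite -pS mulrAC divff ?mul1r// pnatr_eq0.
pose g k := (a k / p k)%R; pose r k := (p (k + i)%N / p k)%R.
have g0 k : (0 <= g k)%R by rewrite divr_ge0.
have r0 k : (0 <= r k)%R by rewrite divr_ge0.
have aE k : a k = (p k * g k)%R by rewrite mulrC divfK ?gt_eqF.
have prE k : (p k * r k = p (k + i)%N)%R by rewrite mulrC divfK ?gt_eqF.
have r_noninc k l : (k <= l)%N -> (r l <= r k)%R.
  apply: (@homo_leq _ r (fun x y => y <= x)%R) => [x//|y x z yx zy|j].
    exact: le_trans zy yx.
  have -> : r j.+1 = (r j * (j.+1%:R / (j + i).+1%:R))%R.
    by rewrite /r addSn !pS'; field; rewrite !gt_eqF ?pnatr_eq0 ?ltr0n.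
  by rewrite ler_piMr// ler_pdivrMr ?ltr0n// mul1r ler_nat ltnS leq_addr.
have gS k : (k.+1%:R * a k.+1 = lambda * p k * g k.+1)%R.
  by rewrite aE mulrA pS.
have gB k : (beta * (lambda * a k) = lambda * p k * (beta * g k))%R.
  by rewrite aE; ring.
have pgfin : \esum_(k in setT) (p k * g k)%:E < +oo.
  by under eq_esum do rewrite -aE.
have [cheb1 cheb2] := chebyshev_sum (fun k => ltW (pgt0 k)) r0 g0 p1 pgfin.
have boundE : bound = (beta ^+ i)%:E * ((\esum_(k in setT) (p k * r k)%:E) *
                              (\esum_(k in setT) (p k * g k)%:E)).
  congr (_ * (_ * _)); first by apply: eq_esum => k _; rewrite prE.
  by apply: eq_esum => k _; rewrite -aE.
have betai0 : 0 <= (beta ^+ i)%:E by rewrite lee_fin exprn_ge0.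
have sumZ : \esum_(k in setT) ((beta ^+ i)%:E * (p k * (r k * g k))%:E) =
    (beta ^+ i)%:E * \esum_(k in setT) (p k * (r k * g k))%:E.
  by rewrite esumZl// => k; rewrite lee_fin mulr_ge0// mulr_ge0.
have termE k : (beta ^+ i * (p k * (r k * g k)) =
    p k * r k * (beta ^+ i * g k))%R by ring.
split=> aS.
- have g_nondec k l : (k <= l)%N -> (g k <= g l)%R.
    apply: (@homo_leq _ g <=%R) => [x//|y x z|j]; first exact: le_trans.
    have /andP[+ _] := aS j; rewrite gS aE mulrA ler_pM2l// mulr_gt0//.
  have g_lip k j : (g (k + j)%N <= beta ^+ j * g k)%R.
    elim: j => [|j IH]; first by rewrite addn0 expr0 mul1r.
    have /andP[_] := aS (k + j)%N.
    rewrite gS gB ler_pM2l ?mulr_gt0// -addnS => /le_trans; apply.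
    by rewrite exprS -mulrA ler_wpM2l.
  rewrite boundE; apply: le_trans (lee_wpmul2l betai0 (cheb1 _)).
    rewrite -sumZ; apply: le_esum => k _; rewrite -EFinM lee_fin aE -prE termE.
    by rewrite ler_wpM2l// mulr_ge0.
  move=> k l; case: (leqP k l) => [kl|/ltnW kl].
    by rewrite mulr_ge0_le0// ?subr_ge0 ?subr_le0 ?r_noninc ?g_nondec.
  by rewrite mulr_le0_ge0// ?subr_ge0 ?subr_le0 ?r_noninc ?g_nondec.
- have g_noninc k l : (k <= l)%N -> (g l <= g k)%R.
    apply: (@homo_leq _ g (fun x y => y <= x)%R) => [x//|y x z yx zy|j].
      exact: le_trans zy yx.
    have /andP[_] := aS j; rewrite gS aE mulrA ler_pM2l// mulr_gt0//.
  have g_lip k j : (beta ^+ j * g k <= g (k + j)%N)%R.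
    elim: j => [|j IH]; first by rewrite addn0 expr0 mul1r.
    have /andP[+ _] := aS (k + j)%N.
    rewrite gS gB ler_pM2l ?mulr_gt0// -addnS.
    by apply: le_trans; rewrite exprS -mulrA ler_wpM2l.
  rewrite boundE; apply: le_trans (lee_wpmul2l betai0 (cheb2 _)) _.
    move=> k l; case: (leqP k l) => [kl|/ltnW kl].
      by rewrite mulr_ge0// ?subr_ge0 ?subr_le0 ?r_noninc ?g_noninc.
    by rewrite mulr_le0// ?subr_ge0 ?subr_le0 ?r_noninc ?g_noninc.
  rewrite -sumZ; apply: le_esum => k _; rewrite -EFinM lee_fin aE -prE termE.
  by rewrite ler_wpM2l// mulr_ge0.
Qed.

End poisson_shift.

(** * Poissonized samples and the Mecke equation *)

Section compound_poisson.
Context {R : realType} {K : choiceType} (q : K -> R) (t : R).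
Hypothesis q0 : forall A, 0 <= q A.
Hypothesis t0 : 0 < t.
Local Open Scope ereal_scope.

(** When q is a probability on K, this is the law of the sequence formed by a
Poisson number of mean t of independent draws from q. *)
Definition sample_weight (x : seq K) : R :=
  poisson_pmf t (size x) * \prod_(A <- x) q A.

Definition sample_mean (G : seq K -> R) : \bar R :=
  \esum_(x in setT) (sample_weight x * G x)%:E.

Definition slice_mean (m : nat) (G : seq K -> R) : \bar R :=
  \esum_(x in [set x | size x = m]) (\prod_(A <- x) q A * G x)%:E.

Definition permutation_invariant (G : seq K -> R) :=
  forall x y, perm_eq x y -> G x = G y.

Lemma prod_weight_ge0 x : (0 <= \prod_(A <- x) q A)%R.
Proof. exact: prodr_ge0. Qed.

Lemma sample_weight_ge0 x : (0 <= sample_weight x)%R.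
Proof. by rewrite mulr_ge0 ?poisson_pmf_ge0 ?prod_weight_ge0. Qed.

Lemma slice_mean_ge0 m G : (forall x, 0 <= G x)%R -> 0 <= slice_mean m G.
Proof.
by move=> G0; apply: esum_ge0 => x _; rewrite lee_fin mulr_ge0 ?prod_weight_ge0.
Qed.

Lemma slice_mean0 G : (forall x, 0 <= G x)%R -> slice_mean 0 G = (G [::])%:E.
Proof.
move=> G0; rewrite /slice_mean (_ : [set _ | _] = [set [::]]).
  by rewrite esum_set1 big_nil mul1r// lee_fin.
by apply/seteqP; split=> [x /size0nil|x ->].
Qed.

Lemma slice_meanS m G : (forall x, 0 <= G x)%R ->
  slice_mean m.+1 G =
  \esum_(A in setT) ((q A)%:E * slice_mean m (fun x => G (A :: x))).
Proof.
move=> G0; rewrite /slice_mean.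
rewrite (reindex_esum (setT `*`` (fun=> [set x : seq K | size x = m])) _
  (fun Ax => Ax.1 :: Ax.2)); last first.
  split=> [[A x] [_ /= ->]//|[A x] [B y] _ _ [-> ->]//|[|A x]//= [xm]].
  by exists (A, x).
rewrite -(@esum_esum _ _ _ _ _
  (fun A x => (\prod_(B <- A :: x) q B * G (A :: x))%:E)); last first.
  by move=> A x _ _; rewrite lee_fin mulr_ge0// prod_weight_ge0.
apply: eq_esum => A _; rewrite -esumZl//=; last first.
  by move=> x; rewrite lee_fin mulr_ge0// prod_weight_ge0.
by apply: eq_esum => x _; rewrite big_cons -EFinM mulrA.
Qed.

Lemma slice_meanD m F G : (forall x, 0 <= F x)%R -> (forall x, 0 <= G x)%R ->
  slice_mean m (fun x => F x + G x)%R = slice_mean m F + slice_mean m G.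
Proof.
move=> F0 G0; rewrite /slice_mean -esumD; last 2 first.
- by move=> x _; rewrite lee_fin mulr_ge0// prod_weight_ge0.
- by move=> x _; rewrite lee_fin mulr_ge0// prod_weight_ge0.
by apply: eq_esum => x _; rewrite -EFinD mulrDr.
Qed.

Lemma slice_meanZ m c G : (0 <= c)%R -> (forall x, 0 <= G x)%R ->
  slice_mean m (fun x => c * G x)%R = c%:E * slice_mean m G.
Proof.
move=> c0 G0; rewrite /slice_mean -esumZl//; last first.
  by move=> x; rewrite lee_fin mulr_ge0// prod_weight_ge0.
by apply: eq_esum => x _; rewrite -EFinM mulrCA.
Qed.

(** By symmetry each of the m + 1 entries of x may be taken to be the first. The
induction isolates the head of x and, for the entries behind it, swaps the head
with the entry singled out, which G does not notice. *)
Lemma slice_campbell m (phi : K -> R) (G : seq K -> R) :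
  (forall A, 0 <= phi A)%R -> (forall x, 0 <= G x)%R ->
  permutation_invariant G ->
  slice_mean m.+1 (fun x => (\sum_(A <- x) phi A) * G x)%R =
  m.+1%:R%:E *
  \esum_(A in setT) ((q A * phi A)%:E * slice_mean m (fun x => G (A :: x))).
Proof.
move=> phi0; elim: m G => [|m IH] G G0 Gperm.
  rewrite mul1e slice_meanS; last first.
    by move=> x; rewrite mulr_ge0// sumr_ge0.
  apply: eq_esum => A _; rewrite !slice_mean0//; last first.
    by move=> x; rewrite mulr_ge0// sumr_ge0.
  by rewrite big_seq1 EFinM EFinM muleA.
set S := \esum_(A in setT) _.
have S0 A : 0 <= (q A * phi A)%:E * slice_mean m.+1 (fun x => G (A :: x)).
  by rewrite mule_ge0// ?lee_fin ?mulr_ge0// slice_mean_ge0.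
rewrite slice_meanS; last by move=> x; rewrite mulr_ge0// sumr_ge0.
transitivity (\esum_(B in setT)
    ((q B * phi B)%:E * slice_mean m.+1 (fun x => G (B :: x)) +
     m.+1%:R%:E * \esum_(A in setT) ((q B)%:E * ((q A * phi A)%:E *
       slice_mean m (fun x => G (B :: A :: x)))))).
  apply: eq_esum => B _.
  transitivity ((q B)%:E * slice_mean m.+1
     (fun x => phi B * G (B :: x) + (\sum_(A <- x) phi A) * G (B :: x))%R).
    by congr (_ * _); apply: eq_esum => x _; rewrite big_cons mulrDl.
  rewrite slice_meanD; last 2 first.
  - by move=> x; rewrite mulr_ge0.
  - by move=> x; rewrite mulr_ge0// sumr_ge0.
  rewrite IH//; last by move=> x y xy; apply: Gperm; rewrite perm_cons.
  rewrite slice_meanZ// ge0_muleDr; last 2 first.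
  - by rewrite mule_ge0 ?lee_fin ?slice_mean_ge0.
  - rewrite mule_ge0// esum_ge0// => A _.
    by rewrite mule_ge0// ?lee_fin ?mulr_ge0// slice_mean_ge0.
  congr (_ + _); first by rewrite EFinM muleA.
  rewrite muleCA; congr (_ * _); rewrite esumZl// => A.
  by rewrite mule_ge0// ?lee_fin ?mulr_ge0// slice_mean_ge0.
have inner0 A B : 0 <= (q B)%:E * ((q A * phi A)%:E *
    slice_mean m (fun x => G (B :: A :: x))).
  by rewrite !mule_ge0// ?lee_fin ?mulr_ge0// slice_mean_ge0.
rewrite esumD//; last first.
  by move=> B _; rewrite mule_ge0// esum_ge0.
rewrite -/S esumZl//; last by move=> B; exact: esum_ge0.
rewrite esum_exchange//.
suff -> : \esum_(A in setT) \esum_(B in setT) ((q B)%:E * ((q A * phi A)%:E *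
    slice_mean m (fun x => G (B :: A :: x)))) = S.
  by rewrite -[X in X + _]mul1e -ge0_muleDl// -EFinD nat1r.
apply: eq_esum => A _.
rewrite slice_meanS// -esumZl ?mulr_ge0//; last first.
  by move=> B; rewrite mule_ge0 ?lee_fin ?slice_mean_ge0.
apply: eq_esum => B _; rewrite muleCA; congr (_ * (_ * _)).
apply: eq_esum => x _; congr (_ * _)%:E; apply: Gperm.
exact: permEl (perm_catCA [:: B] [:: A] x).
Qed.

Lemma sample_meanE G : (forall x, 0 <= G x)%R ->
  sample_mean G = \esum_(m in setT) ((poisson_pmf t m)%:E * slice_mean m G).
Proof.
move=> G0; rewrite /sample_mean.
rewrite (_ : setT = \bigcup_(m in setT) [set x : seq K | size x = m]); last first.
  by apply/seteqP; split=> // x _; exists (size x).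
rewrite esum_bigcupT; last 2 first.
- by move=> i j _ _ [x /= [<-]].
- by move=> x; rewrite lee_fin mulr_ge0// sample_weight_ge0.
apply: eq_esum => m _; rewrite -esumZl ?poisson_pmf_ge0//; last first.
  by move=> x; rewrite lee_fin mulr_ge0// prod_weight_ge0.
by apply: eq_esum => x /= xm; rewrite -EFinM /sample_weight xm mulrA.
Qed.

Lemma poisson_pmfS m : (m.+1%:R * poisson_pmf t m.+1 = t * poisson_pmf t m)%R.
Proof.
rewrite /poisson_pmf t0 factS natrM exprS; field.
by rewrite nat1r !pnatr_eq0 -lt0n fact_gt0.
Qed.

Lemma sample_mean_ge0 G : (forall x, 0 <= G x)%R -> 0 <= sample_mean G.
Proof.
by move=> G0; apply: esum_ge0 => x _; rewrite lee_fin mulr_ge0// sample_weight_ge0.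
Qed.

(** A point removed from a Poisson sample leaves a Poisson sample: the m + 1
choices of a point in a sample of size m + 1 are absorbed by
(m + 1) P(n = m + 1) = t P(n = m). *)
Lemma campbell_mecke (phi : K -> R) (G : seq K -> R) :
  (forall A, 0 <= phi A)%R -> (forall x, 0 <= G x)%R ->
  permutation_invariant G ->
  sample_mean (fun x => (\sum_(A <- x) phi A) * G x)%R =
  t%:E * \esum_(A in setT)
    ((q A * phi A)%:E * sample_mean (fun x => G (A :: x))).
Proof.
move=> phi0 G0 Gperm.
have PG0 x : (0 <= (\sum_(A <- x) phi A) * G x)%R by rewrite mulr_ge0// sumr_ge0.
have term0 m A : 0 <= (poisson_pmf t m)%:E * ((q A * phi A)%:E *
    slice_mean m (fun x => G (A :: x))).
  by rewrite !mule_ge0// ?lee_fin ?poisson_pmf_ge0 ?mulr_ge0// slice_mean_ge0.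
rewrite sample_meanE// esum_natS => [|m]; last first.
  by rewrite mule_ge0// ?lee_fin ?poisson_pmf_ge0// slice_mean_ge0.
rewrite slice_mean0// big_nil mul0r mule0 add0e.
transitivity (\esum_(m in setT) (t%:E * \esum_(A in setT)
    ((poisson_pmf t m)%:E * ((q A * phi A)%:E *
      slice_mean m (fun x => G (A :: x)))))).
  apply: eq_esum => m _; rewrite slice_campbell// muleA -EFinM mulrC poisson_pmfS.
  rewrite EFinM -muleA esumZl ?poisson_pmf_ge0// => A.
  by rewrite mule_ge0// ?lee_fin ?mulr_ge0// slice_mean_ge0.
rewrite esumZl ?ltW// => [|m]; last exact: esum_ge0.
congr (_ * _); rewrite esum_exchange//; apply: eq_esum => A _.
rewrite sample_meanE// -esumZl ?mulr_ge0// => [|m].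
  by apply: eq_esum => m _; rewrite muleCA.
by rewrite mule_ge0// ?lee_fin ?poisson_pmf_ge0// slice_mean_ge0.
Qed.

End compound_poisson.

(** * Level sets of the number of samples with a given property *)

Section level_sets.
Context {R : realType} {K : choiceType} (q : K -> R) (t : R).
Hypothesis q0 : forall A, 0 <= q A.
Hypothesis q1 : (\esum_(A in setT) (q A)%:E = 1)%E.
Hypothesis t0 : 0 < t.
Local Open Scope ereal_scope.
Local Notation mean := (sample_mean q t).

Lemma sample_mean1 : mean (fun=> 1%R) = 1.
Proof.
rewrite sample_meanE//.
have slice1 m : slice_mean q m (fun=> 1%R) = 1.
  elim: m => [|m IH]; first by rewrite slice_mean0.
  rewrite slice_meanS//; under eq_esum do rewrite IH mule1.
  exact: q1.
under eq_esum do rewrite slice1 mule1.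
have : poisson_prob t 0%N setT = 1 := probability_setT (poisson_prob t 0%N).
by rewrite /poisson_prob t0.
Qed.

Lemma le_sample_mean F G : (forall x, F x <= G x)%R ->
  mean F <= mean G.
Proof.
move=> FG; apply: le_esum => x _; rewrite lee_fin ler_wpM2l//.
exact: sample_weight_ge0.
Qed.

Lemma sample_meanD F G : (forall x, 0 <= F x)%R -> (forall x, 0 <= G x)%R ->
  mean (fun x => F x + G x)%R = mean F + mean G.
Proof.
move=> F0 G0; rewrite /sample_mean -esumD; last 2 first.
- by move=> x _; rewrite lee_fin mulr_ge0// sample_weight_ge0.
- by move=> x _; rewrite lee_fin mulr_ge0// sample_weight_ge0.
by apply: eq_esum => x _; rewrite -EFinD mulrDr.
Qed.

Lemma sample_meanZ c G : (0 <= c)%R -> (forall x, 0 <= G x)%R ->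
  mean (fun x => c * G x)%R = c%:E * mean G.
Proof.
move=> c0 G0; rewrite /sample_mean -esumZl//; last first.
  by move=> x; rewrite lee_fin mulr_ge0// sample_weight_ge0.
by apply: eq_esum => x _; rewrite -EFinM mulrCA.
Qed.

Lemma sample_mean_sum (I : eqType) (r : seq I) (F : I -> seq K -> R) :
  (forall i x, 0 <= F i x)%R ->
  mean (fun x => \sum_(i <- r) F i x)%R = \sum_(i <- r) mean (F i).
Proof.
move=> F0; elim: r => [|i r IH].
  rewrite big_nil; apply: esum1 => x _; by rewrite big_nil mulr0.
rewrite big_cons -IH -sample_meanD//; last first.
  by move=> x; rewrite sumr_ge0.
by apply: eq_esum => x _; rewrite big_cons.
Qed.

Definition level_mean (N : seq K -> nat) (k : nat) (G : seq K -> R) :=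
  mean (fun x => (N x == k)%:R * G x)%R.

Lemma level_mean_ge0 N k G : (forall x, 0 <= G x)%R -> 0 <= level_mean N k G.
Proof. by move=> G0; apply: sample_mean_ge0 => // x; rewrite mulr_ge0. Qed.

Lemma sample_mean_levels N G : (forall x, 0 <= G x)%R ->
  mean G = \esum_(k in setT) level_mean N k G.
Proof.
move=> G0; rewrite /level_mean /sample_mean esum_exchange => [|k x]; last first.
  by rewrite lee_fin mulr_ge0 ?sample_weight_ge0 ?mulr_ge0.
apply: eq_esum => x _.
rewrite (esumID [set N x]) => [|k _]; last first.
  by rewrite lee_fin mulr_ge0 ?sample_weight_ge0 ?mulr_ge0.
rewrite !setTI esum_set1; last by rewrite lee_fin mulr_ge0 ?sample_weight_ge0 ?mulr_ge0.
rewrite esum1 ?adde0 ?eqxx ?mul1r// => k /= /eqP/negbTE kN.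
by rewrite eq_sym kN mul0r mulr0.
Qed.

Lemma tail_mean_levels N i G : (forall x, 0 <= G x)%R ->
  mean (fun x => (i <= N x)%:R * G x)%R =
  \esum_(k in setT) level_mean N (k + i) G.
Proof.
move=> G0; rewrite (@sample_mean_levels N) => [|x]; last by rewrite mulr_ge0.
rewrite -(@reindex_esum R _ _ setT [set k | (i <= k)%N] (addn^~ i)
  (fun k => level_mean N k G)); last first.
  split=> [k _ /=|k l _ _ /addIn//|k /= ik]; first exact: leq_addl.
  by exists (k - i)%N => //; rewrite subnK.
rewrite [RHS]esum_mkcond; apply: eq_esum => k _.
case: ifPn; rewrite ?inE/= ?notin_setE/= => ik.
  apply: eq_esum => x _; congr (_ * _)%:E.
  by case: eqP => [->|]; rewrite ?mul0r// ik !mul1r.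
apply: esum1 => x _; case: eqP => [->|]; rewrite ?mul0r ?mulr0//.
by rewrite (negbTE (introN idP ik)) !(mul0r, mulr0).
Qed.

(** On the level k + 1 any of the k + 1 samples satisfying h can be singled out,
and removing it leaves a sample on the level k. *)
Lemma level_mean_recurrence (h : pred K) k G : (forall x, 0 <= G x)%R ->
  permutation_invariant G ->
  k.+1%:R%:E * level_mean (count h) k.+1 G =
  t%:E * \esum_(A in setT)
    ((q A * (h A)%:R)%:E * level_mean (count h) k (fun x => G (A :: x))).
Proof.
move=> G0 Gperm; rewrite -sample_meanZ// => [|x]; last by rewrite mulr_ge0.
pose F (x : seq K) : R := ((count h x == k.+1)%:R * G x)%R.
have -> : mean (fun x => k.+1%:R * ((count h x == k.+1)%:R * G x))%R =
    mean (fun x => (\sum_(A <- x) (h A)%:R) * F x)%R.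
  apply: eq_esum => x _; congr (_ * _)%:E; rewrite /F.
  case: eqP => [cx|]; rewrite ?mul0r ?mulr0//.
  by rewrite -natr_sum -big_mkcond sum1_count cx.
rewrite campbell_mecke//; last 2 first.
- by move=> x; rewrite mulr_ge0.
- by move=> x y xy; rewrite /F (permP xy) (Gperm x y xy).
congr (_ * _); apply: eq_esum => A _; case: (boolP (h A)) => hA; last first.
  by rewrite mulr0 !mul0e.
congr (_ * _); apply: eq_esum => x _.
by rewrite /F /= hA add1n eqSS.
Qed.

End level_sets.

(** * Conditioning on i samples with a given property *)

Section conditioning.
Context {R : realType} {K : choiceType} (q : K -> R) (t : R).
Hypothesis q0 : forall A, 0 <= q A.
Hypothesis q1 : (\esum_(A in setT) (q A)%:E = 1)%E.
Hypothesis t0 : 0 < t.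
Local Open Scope ereal_scope.
Local Notation mean := (sample_mean q t).
Local Notation level := (level_mean q t).

Lemma level_mean_lty N k G : (forall x, 0 <= G x)%R ->
  mean G < +oo -> level N k G < +oo.
Proof.
move=> G0; apply: le_lt_trans; apply: le_sample_mean => // x.
by case: eqP => _; rewrite ?mul1r ?mul0r.
Qed.

(** The hypotheses needed by [poisson_conditioning], with lambda the mean number
of samples satisfying h; the case l = u = 1 of a constant F is the recurrence
between Poisson probabilities. *)
Lemma level_mean_bounds (h : pred K) (k : nat) (F : seq K -> R) (l u : R) :
  (0 <= l)%R -> (0 <= u)%R -> (forall x, 0 <= F x)%R ->
  permutation_invariant F -> mean F < +oo ->
  (forall A x, q A != 0 -> h A -> l * F x <= F (A :: x) <= u * F x)%R ->
  forall (lambda : R) (a : nat -> R),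
  lambda%:E = t%:E * (\esum_(A in setT) (q A * (h A)%:R)%:E) ->
  (forall k, (a k)%:E = level (count h) k F) ->
  (l * (lambda * a k) <= k.+1%:R * a k.+1 <= u * (lambda * a k))%R.
Proof.
move=> l0 u0 F0 Fperm Ffin lFu lambda a lambdaE aE.
have t0' : 0 <= t%:E by rewrite lee_fin ltW.
have hq0 A : 0 <= (q A * (h A)%:R)%:E by rewrite lee_fin mulr_ge0.
have a0 : (0 <= a k)%R by rewrite -lee_fin aE level_mean_ge0.
have sumE (b : R) : (0 <= b)%R -> (b * (lambda * a k))%:E =
    t%:E * \esum_(A in setT) ((q A * (h A)%:R)%:E * (b * a k)%:E).
  move=> b0; under eq_esum do rewrite muleC.
  rewrite esumZl ?mulr_ge0// muleCA -lambdaE -EFinM; congr (_%:E).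
  by ring.
have lvlE (b : R) : (0 <= b)%R ->
    (b * a k)%:E = level (count h) k (fun x => b * F x)%R.
  move=> b0; rewrite EFinM aE -sample_meanZ// => [|x]; last by rewrite mulr_ge0.
  by apply: eq_esum => x _; congr (_ * _)%:E; rewrite mulrCA.
have midE : (k.+1%:R * a k.+1)%:E = t%:E * \esum_(A in setT)
    ((q A * (h A)%:R)%:E * level (count h) k (fun x => F (A :: x))).
  by rewrite EFinM aE level_mean_recurrence.
rewrite -!lee_fin midE !sumE//.
rewrite !lee_wpmul2l//; apply: le_esum => A _;
  case: (boolP (h A)) => hA; rewrite ?mulr0 ?mul0e// mulr1;
  have [->|qA] := eqVneq (q A) 0%R; rewrite ?mul0e//;
  rewrite lee_wpmul2l ?lee_fin// lvlE//; apply: le_sample_mean => // x;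
  by have /andP[? ?] := lFu A x qA hA; rewrite ler_wpM2l.
Qed.

(** Conditioning on i samples satisfying h adds at most i such samples, and each
of them changes G by a factor between 1 and beta. The two parts are meant for
beta >= 1 and for beta <= 1. *)
Lemma tail_conditioning (h : pred K) (G : seq K -> R) (beta : R) (i : nat) :
  (0 <= beta)%R -> (0 < i)%N -> (forall x, 0 <= G x)%R ->
  permutation_invariant G -> mean G < +oo ->
  let tail := mean (fun x => (i <= count h x)%:R * G x)%R in
  let bound := (beta ^+ i)%:E *
    (mean (fun x => (i <= count h x)%:R)%R * mean G) in
  ((forall A x, q A != 0 -> h A -> G x <= G (A :: x) <= beta * G x)%R ->
     tail <= bound) /\
  ((forall A x, q A != 0 -> h A -> beta * G x <= G (A :: x) <= G x)%R ->
     bound <= tail).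
Proof.
move=> beta0 i0 G0 Gperm Gfin tail bound.
pose lambda := fine (t%:E * (\esum_(A in setT) (q A * (h A)%:R)%:E)).
have hq0 A : 0 <= (q A * (h A)%:R)%:E by rewrite lee_fin mulr_ge0.
have lambda0 : 0 <= t%:E * (\esum_(A in setT) (q A * (h A)%:R)%:E).
  by rewrite mule_ge0 ?esum_ge0// lee_fin ltW.
have lambdaE : lambda%:E = t%:E * (\esum_(A in setT) (q A * (h A)%:R)%:E).
  rewrite fineK// ge0_fin_numE//.
  apply: (@le_lt_trans _ _ (t%:E * 1)); last by rewrite mule1 ltry.
  rewrite lee_wpmul2l ?lee_fin ?(ltW t0)// -q1; apply: le_esum => A _.
  by rewrite lee_fin; case: (h A); rewrite ?mulr1 ?mulr0.
have lvlE k F : (forall x, 0 <= F x)%R -> mean F < +oo ->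
    (fine (level (count h) k F))%:E = level (count h) k F.
  move=> F0 Ffin; rewrite fineK// ge0_fin_numE; first exact: level_mean_lty.
  exact: level_mean_ge0.
have mean1 : mean (fun=> 1%R) = 1 by exact: sample_mean1.
have fin1 : mean (fun=> 1%R) < +oo by rewrite mean1 ltry.
pose p k := fine (level (count h) k (fun=> 1%R)).
pose a k := fine (level (count h) k G).
have pE k : (p k)%:E = level (count h) k (fun=> 1%R) by rewrite lvlE.
have aE k : (a k)%:E = level (count h) k G by rewrite lvlE.
have p0 k : (0 <= p k)%R by rewrite fine_ge0// level_mean_ge0.
have a0 k : (0 <= a k)%R by rewrite fine_ge0// level_mean_ge0.
have pS k : (k.+1%:R * p k.+1 = lambda * p k)%R.
  have := @level_mean_bounds h k (fun=> 1%R) 1 1 ler01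
    ler01 (fun=> ler01) (fun _ _ _ => erefl) fin1 _ lambda p lambdaE pE.
  rewrite !mul1r => le_p; apply/esym/le_anti; rewrite le_p// => *.
  by rewrite lexx.
have p1 : \esum_(k in setT) (p k)%:E = 1.
  rewrite -mean1 (@sample_mean_levels _ _ _ _ q0 (count h))//.
  by apply: eq_esum => k _; rewrite pE.
have sum_a : \esum_(k in setT) (a k)%:E = mean G.
  rewrite (@sample_mean_levels _ _ _ _ q0 (count h))//.
  by apply: eq_esum => k _; rewrite aE.
have tailE : tail = \esum_(k in setT) (a (k + i)%N)%:E.
  by rewrite /tail tail_mean_levels//; apply: eq_esum => k _; rewrite aE.
have boundE : bound = (beta ^+ i)%:E *
    ((\esum_(k in setT) (p (k + i)%N)%:E) * (\esum_(k in setT) (a k)%:E)).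
  rewrite /bound sum_a; congr (_ * (_ * _)).
  under [RHS]eq_esum do rewrite pE.
  rewrite -tail_mean_levels//.
  by apply: eq_esum => x _; rewrite mulr1.
have [] := poisson_conditioning (fine_ge0 lambda0) beta0 i0 p0 a0 pS p1
  (_ : \esum_(k in setT) (a k)%:E < +oo); first by rewrite sum_a.
rewrite -tailE -boundE => up down; split=> hG; [apply: up|apply: down] => k.
- have := @level_mean_bounds h k G 1 beta ler01 beta0 G0 Gperm Gfin _
    lambda a lambdaE aE.
  by rewrite mul1r; apply => A x qA hA; rewrite mul1r hG.
- have := @level_mean_bounds h k G beta 1 beta0 ler01 G0 Gperm Gfin _
    lambda a lambdaE aE.
  by rewrite mul1r; apply => A x qA hA; rewrite mul1r hG.
Qed.

End conditioning.

(** * The moment generating function of the number of species seen *)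

Section species_statistic.
Context {R : realType} {S : choiceType} (q : {fset S} -> R) (t : R) (B i : nat).
Hypothesis q0 : forall A, 0 <= q A.
Hypothesis q1 : (\esum_(A in setT) (q A)%:E = 1)%E.
Hypothesis t0 : 0 < t.
Hypothesis qB : forall A, q A != 0 -> (#|` A| <= B)%N.
Hypothesis B0 : (0 < B)%N.
Hypothesis i0 : (0 < i)%N.
Local Notation mean := (sample_mean q t).

Definition containing (s : S) (x : seq {fset S}) : nat :=
  count (fun A : {fset S} => s \in A) x.

Definition seen_in (F : seq S) (x : seq {fset S}) : nat :=
  count (fun s => i <= containing s x)%N F.

Definition seen_prob (s : S) : R :=
  fine (mean (fun x => (i <= containing s x)%:R)).

Local Notation c := ((B%:R - 1) * i%:R + 1 : R).

Lemma seen_in_le F x : (seen_in F x <= size F)%N.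
Proof. exact: count_size. Qed.

Lemma seen_in_perm F x y : perm_eq x y -> seen_in F x = seen_in F y.
Proof. by move=> /permP xy; apply: eq_count => s; rewrite /containing xy. Qed.

Lemma seen_in_rem F s x : s \in F ->
  seen_in F x = ((i <= containing s x) + seen_in (rem s F) x)%N.
Proof. by move=> /perm_to_rem/permP; exact. Qed.

(** As s is not in F, a sample containing s has at most B - 1 elements in F, and
only these can reach the threshold i when the sample is added. *)
Lemma seen_in_cons F s A x : uniq F -> s \notin F -> s \in A -> (#|` A| <= B)%N ->
  (seen_in F x <= seen_in F (A :: x) <= seen_in F x + B.-1)%N.
Proof.
move=> uF sF sA AB; apply/andP; split.
  by apply: sub_count => v /leq_trans; apply; exact: leq_addl.
apply: (@leq_trans (seen_in F x + count (fun v => v \in A) F)%N).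
  rewrite /seen_in -count_predUI; apply: leq_trans (leq_addr _ _).
  apply: sub_count => v /=; case: (v \in A) => /=; rewrite ?orbT// orbF.
  by rewrite /containing /= add0n.
rewrite leq_add2l; apply: (@leq_trans #|` (A `\ s)%fset|).
  rewrite -size_filter; apply: uniq_leq_size; first exact: filter_uniq.
  move=> v; rewrite mem_filter !inE => /andP[vA vF]; rewrite vA andbT.
  by apply: contraNneq sF => <-.
by move: AB; rewrite (cardfsD1 s A) sA add1n; case: B B0.
Qed.

Lemma mean_bounded_lty (G : seq {fset S} -> R) (C : R) : 0 <= C ->
  (forall x, G x <= C) -> (mean G < +oo)%E.
Proof.
move=> C0 GC.
apply: (@le_lt_trans _ _ (mean (fun=> C * 1))).
  by apply: le_sample_mean => // x; rewrite mulr1.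
by rewrite sample_meanZ// sample_mean1// mule1 ltry.
Qed.

Lemma seen_probE s :
  (seen_prob s)%:E = mean (fun x => (i <= containing s x)%:R).
Proof.
rewrite fineK// ge0_fin_numE; last exact: sample_mean_ge0.
by apply: (mean_bounded_lty ler01) => x; rewrite lern1 leq_b1.
Qed.

Lemma seen_prob_ge0 s : 0 <= seen_prob s.
Proof. by rewrite fine_ge0// sample_mean_ge0. Qed.

Lemma expR_seen_lty F theta :
  (mean (fun x => expR (theta * (seen_in F x)%:R)) < +oo)%E.
Proof.
apply: (mean_bounded_lty (expR_ge0 (`|theta| * (size F)%:R))) => x.
rewrite ler_expR; apply: (@le_trans _ _ (`|theta| * (seen_in F x)%:R)).
  by rewrite ler_wpM2r// ler_norm.
by rewrite ler_wpM2l// ler_nat seen_in_le.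
Qed.

Lemma expR_growth theta :
  expR theta * expR (theta * (B%:R - 1)) ^+ i = expR (c * theta).
Proof. by rewrite -expRM_natr -expRD; congr expR; ring. Qed.

(** Treating s apart from the other species is what produces (B - 1) i + 1 rather
than B i: the at most i samples added by the conditioning contribute up to B - 1
other species each, but s itself only once. *)
Lemma size_bias_species F s theta : uniq F -> s \in F ->
  let m := mean (fun x => expR (theta * (seen_in F x)%:R)) in
  let biased := mean
    (fun x => (i <= containing s x)%:R * expR (theta * (seen_in F x)%:R)) in
  (0 <= theta -> (biased <= (seen_prob s * expR (c * theta))%:E * m)%E) /\
  (theta <= 0 -> ((seen_prob s * expR (c * theta))%:E * m <= biased)%E).
Proof.
move=> uF sF m biased.
pose G x := expR (theta * (seen_in (rem s F) x)%:R).
have G0 x : 0 <= G x by exact: expR_ge0.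
have mGfin : (mean G < +oo)%E by exact: expR_seen_lty.
have GP : permutation_invariant G.
  by move=> x y xy; rewrite /G (seen_in_perm _ xy).
have expE x : expR (theta * (seen_in F x)%:R) =
    expR (theta * (i <= containing s x)%:R) * G x.
  by rewrite (seen_in_rem _ sF) natrD mulrDr expRD.
have biasedE : biased = ((expR theta)%:E *
    mean (fun x => (i <= containing s x)%:R * G x)%R)%E.
  rewrite -sample_meanZ ?expR_ge0//; last by move=> x; rewrite mulr_ge0.
  apply: eq_esum => x _; congr (_ * _)%:E; rewrite expE.
  by case: leqP => _; rewrite ?mul0r ?mulr0// !mul1r mulr1.
have boundE (y : \bar R) : ((expR theta)%:E *
    ((expR (theta * (B%:R - 1)) ^+ i)%:E * ((seen_prob s)%:E * y)) =
    (seen_prob s * expR (c * theta))%:E * y)%E.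
  by rewrite !muleA -!EFinM expR_growth (mulrC (seen_prob s)).
have [up down] := @tail_conditioning R {fset S} q t q0 q1 t0
  (fun A : {fset S} => s \in A) G (expR (theta * (B%:R - 1))) i
  (expR_ge0 _) i0 G0 GP mGfin.
have B1 : (B.-1)%:R = B%:R - 1 :> R by rewrite -[in RHS](prednK B0) -natr1 addrK.
have step A x : q A != 0 -> s \in A -> (seen_in (rem s F) x <=
    seen_in (rem s F) (A :: x) <= seen_in (rem s F) x + B.-1)%N.
  move=> qA sA; apply: (seen_in_cons _ _ _ sA (qB qA)); first exact: rem_uniq.
  by rewrite mem_rem_uniqF.
split=> th.
- apply: (@le_trans _ _ ((seen_prob s * expR (c * theta))%:E * mean G)%E).
    rewrite biasedE -boundE lee_wpmul2l ?lee_fin ?expR_ge0// seen_probE; apply: up.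
    move=> A x qA sA; have /andP[lo hi] := step A x qA sA.
    rewrite -expRD !ler_expR -mulrDr !ler_wpM2l ?ler_nat//.
    by rewrite addrC -B1 -natrD ler_nat.
  rewrite lee_wpmul2l ?lee_fin ?mulr_ge0 ?seen_prob_ge0 ?expR_ge0//.
  apply: le_sample_mean => // x; rewrite expE ler_peMl// -expR0 ler_expR.
  by rewrite mulr_ge0.
- apply: (@le_trans _ _ ((seen_prob s * expR (c * theta))%:E * mean G)%E).
    rewrite lee_wpmul2l ?lee_fin ?mulr_ge0 ?seen_prob_ge0 ?expR_ge0//.
    apply: le_sample_mean => // x; rewrite expE ler_piMl// -expR0 ler_expR.
    by rewrite mulr_le0_ge0.
  rewrite biasedE -boundE lee_wpmul2l ?lee_fin ?expR_ge0// seen_probE; apply: down.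
  move=> A x qA sA; have /andP[lo hi] := step A x qA sA.
  rewrite -expRD !ler_expR -mulrDr !ler_wnM2l ?ler_nat//.
  by rewrite addrC -B1 -natrD ler_nat.
Qed.

(** The statistic takes finitely many values, so that its moment generating
function is a finite sum of exponentials and can be differentiated termwise. *)
Lemma mean_of_seen_in F (f : nat -> R) : (forall k, 0 <= f k) ->
  mean (fun x => f (seen_in F x)) =
  (\sum_(k < (size F).+1) f k * fine (level_mean q t (seen_in F) k (fun=> 1)))%:E.
Proof.
move=> f0; rewrite -sumEFin.
transitivity (mean (fun x => \sum_(k < (size F).+1)
    f k * ((seen_in F x == k)%:R * 1))).
  apply: eq_esum => x _; congr (_ * _)%:E.
  have xF : (seen_in F x < (size F).+1)%N by rewrite ltnS seen_in_le.
  rewrite (bigD1 (Ordinal xF))//= eqxx !mulr1 big1 ?addr0// => k.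
  rewrite -val_eqE/= eq_sym => /negbTE ->; by rewrite mul0r mulr0.
rewrite sample_mean_sum//; last by move=> k x; rewrite !mulr_ge0.
apply: eq_bigr => k _; rewrite sample_meanZ//.
rewrite EFinM fineK// ge0_fin_numE; last exact: level_mean_ge0.
apply: level_mean_lty => //.
by rewrite sample_mean1 ?ltry.
Qed.

Lemma species_mgf_le F theta : uniq F ->
  (mean (fun x => expR (theta * (seen_in F x)%:R)) <=
   (expR ((\sum_(s <- F) seen_prob s) * ((expR (c * theta) - 1) / c)))%:E)%E.
Proof.
move=> uF; set M := \sum_(s <- F) _.
pose p k := fine (level_mean q t (seen_in F) k (fun=> 1)).
pose m (th : R) := \sum_(k < (size F).+1) expR (th * k%:R) * p k.
pose m' (th : R) := \sum_(k < (size F).+1) (k%:R * expR (th * k%:R)) * p k.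
have mE th : mean (fun x => expR (th * (seen_in F x)%:R)) = (m th)%:E.
  by rewrite (@mean_of_seen_in F (fun k => expR (th * k%:R)))// => k; exact: expR_ge0.
have m'E th : (m' th)%:E = (\sum_(s <- F) mean
    (fun x => (i <= containing s x)%:R * expR (th * (seen_in F x)%:R))%R)%E.
  rewrite -(@mean_of_seen_in F (fun k => k%:R * expR (th * k%:R))); last first.
    by move=> k; rewrite mulr_ge0// expR_ge0.
  rewrite -sample_mean_sum//.
  apply: eq_esum => x _; congr (_ * _)%:E; rewrite -mulr_suml; congr (_ * _).
  by rewrite -natr_sum -big_mkcond sum1_count.
have ME th : (M * expR (c * th) * m th)%:E =
    (\sum_(s <- F) (seen_prob s * expR (c * th))%:E * (m th)%:E)%E.
  by rewrite /M !mulr_suml -sumEFin.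
have c1 : 1 <= c by rewrite lerDr mulr_ge0// subr_ge0 ler1n.
rewrite mE lee_fin; apply: (@gronwall_le _ m m').
- by rewrite gt_eqF// (lt_le_trans ltr01).
- move=> x.
  rewrite (_ : m = \sum_(k < (size F).+1) (fun th => expR (th * k%:R) * p k)).
    apply: is_derive_sum => k; apply: is_derive_eq.
    by rewrite /GRing.scale/=; ring.
  by apply/funext => y; rewrite fct_sumE.
- apply: EFin_inj; rewrite -mE -[RHS](sample_mean1 q0 q1 t0).
  by apply: eq_esum => x _; rewrite mul0r expR0.
- move=> th th0; rewrite -lee_fin m'E ME big_seq [leRHS]big_seq.
  apply: lee_sum => s sF; rewrite -mE.
  by have [+ _] := @size_bias_species F s th uF sF; exact.
- move=> th th0; rewrite -lee_fin m'E ME big_seq [leRHS]big_seq.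
  apply: lee_sum => s sF; rewrite -mE.
  by have [_ +] := @size_bias_species F s th uF sF; exact.
Qed.

(** A species seen at all accounts for at least one incidence between species and
samples, and the expected number of incidences is t times the mean size of a
sample. The bound is uniform in F, hence makes the expectation of the number of
all species seen finite. *)
Lemma seen_prob_sum_le F : uniq F -> \sum_(s <- F) seen_prob s <= t * B%:R.
Proof.
move=> uF; rewrite -lee_fin -sumEFin; under eq_bigr do rewrite seen_probE.
rewrite -sample_mean_sum//.
apply: (@le_trans _ _ (mean
    (fun x => (\sum_(A <- x) (count (fun s => s \in A) F)%:R) * 1))).
  apply: le_sample_mean => // x; rewrite mulr1 -!natr_sum ler_nat.
  have -> : (\sum_(A <- x) count (fun s => s \in A) F =
      \sum_(s <- F) containing s x)%N.
    transitivity (\sum_(A <- x) \sum_(s <- F) (s \in A : nat))%N.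
      by apply: eq_bigr => A _; rewrite -sum1_count big_mkcond.
    rewrite exchange_big; apply: eq_bigr => s _.
    by rewrite /containing -sum1_count [RHS]big_mkcond.
  apply: leq_sum => s _; by case: (leqP i) => // ix; exact: leq_trans i0 ix.
rewrite (@campbell_mecke _ _ q t q0 t0
  (fun A : {fset S} => (count (fun s => s \in A) F)%:R) (fun=> 1))//.
rewrite EFinM lee_wpmul2l ?lee_fin ?(ltW t0)//.
rewrite sample_mean1//.
apply: (@le_trans _ _ (\esum_(A in setT) (B%:R%:E * (q A)%:E))%E).
  apply: le_esum => A _; rewrite mule1 mulrC -EFinM lee_fin.
  have [->|qA] := eqVneq (q A) 0; first by rewrite !mulr0.
  rewrite ler_wpM2r// ler_nat; apply: leq_trans (qB qA).
  rewrite -size_filter; apply: uniq_leq_size; first exact: filter_uniq.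
  by move=> v; rewrite mem_filter => /andP[].
by rewrite esumZl// q1 mule1.
Qed.

End species_statistic.

(** * Countable families *)

Section countable_sums.
Context {R : realType}.
Local Open Scope ereal_scope.

Lemma esum_pickle (I : countType) (a : I -> \bar R) : (forall i, 0 <= a i) ->
  \esum_(i in setT) a i = \sum_(0 <= k <oo) oapp a 0 (pickle_inv k).
Proof.
move=> a0; have oa0 k : 0 <= oapp a 0 (pickle_inv k).
  by case: (pickle_inv k) => /=.
rewrite nneseries_esumT//.
transitivity (\esum_(k in choice.pickle @` [set: I]) oapp a 0 (pickle_inv k)).
  rewrite esum_image; last by move=> i j _ _; exact: (pcan_inj pickleK_inv).
  by apply: eq_esum => i _; rewrite pickleK_inv.
rewrite esum_mkcond; apply: eq_esum => k _.
case: ifPn => //; rewrite notin_setE => nk.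
case E : (pickle_inv k) => [i|//]; exfalso; apply: nk; exists i => //.
by have := @pickle_invK I k; rewrite E.
Qed.

Lemma measure_countable_bigcup d (T : measurableType d)
    (mu : {measure set T -> \bar R}) (I : countType) (D : set I) (F : I -> set T) :
  (forall i, D i -> measurable (F i)) -> trivIset D F ->
  mu (\bigcup_(i in D) F i) = \esum_(i in D) mu (F i).
Proof.
move=> mF tF; rewrite esum_mkcond esum_pickle; last by move=> i; case: ifP.
pose G k := oapp (fun i => if i \in D then F i else set0) set0 (pickle_inv k).
have GE : \bigcup_(i in D) F i = \bigcup_k G k.
  apply/seteqP; split=> [w [i Di Fw]|w [k _]].
    by exists (choice.pickle i) => //; rewrite /G pickleK_inv/= mem_set.
  rewrite /G; case: (pickle_inv k) => [i|//] /=; case: ifPn => // /set_mem Di Fw.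
  by exists i.
have mG k : measurable (G k).
  by rewrite /G; case: (pickle_inv k) => //= i; case: ifPn => // /set_mem /mF.
rewrite GE measure_semi_bigcup//; last 2 first.
- move=> k l _ _ [w []]; rewrite /G.
  case Ek : (pickle_inv k) => [i|//] /=; case: ifPn => // /set_mem Di Fi.
  case El : (pickle_inv l) => [j|//] /=; case: ifPn => // /set_mem Dj Fj.
  have ij : i = j by apply: tF => //; exists w.
  have := @pickle_invK I k; have := @pickle_invK I l.
  by rewrite Ek El /= ij => -> ->.
- exact: bigcup_measurable.
apply: eq_eseriesr => k _; rewrite /G; case: (pickle_inv k) => [i|] /=.
  by case: ifP => // _; rewrite measure0.
by rewrite measure0.
Qed.

End countable_sums.

(** * Measurability in the powerset of a countable set *)

Section powerset_measurability.
Context {S : countType}.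

Lemma measurable_coordinate (s : S) :
  measurable ([set A | A s] : set (powersetType S)).
Proof. by apply: sub_sigma_algebra; exists s. Qed.

Lemma measurable_singleton (A : set S) :
  measurable ([set A] : set (powersetType S)).
Proof.
rewrite (_ : [set A] = ~` \bigcup_s [set A' : set S | ~ (A' s <-> A s)]).
  apply: measurableC; apply: countable_bigcupT_measurable => // s.
  have [As|nAs] := pselect (A s).
    rewrite (_ : [set _ | _] = ~` [set A' | A' s]); last first.
      by apply/seteqP; split=> A' /=; rewrite /setC/=; tauto.
    by apply: measurableC; exact: measurable_coordinate.
  rewrite (_ : [set _ | _] = [set A' | A' s]); last first.
    by apply/seteqP; split=> A' /=; have := EM (A' s); tauto.
  exact: measurable_coordinate.
apply/seteqP; split=> [A' -> [s _ /=]|A' /= nA']; first by apply.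
apply/funext => s; apply/propext; apply: contrapT => ns.
by apply: nA'; exists s.
Qed.

End powerset_measurability.

(** * The law of the sample *)

Section sampling_law.
Context (R : realType) (S : countType) (mu : probability (powersetType S) R)
  (B : nat) (t : R) (d : measure_display) (T : measurableType d)
  (P : probability T R) (n : {RV P >-> nat}) (X : nat -> {RV P >-> powersetType S}).
Hypothesis hmu : supported_on_finite_sets mu.
Hypothesis hmuB : size_bounded mu B.
Hypothesis t0 : 0 < t.
Hypothesis hX : poissonized_sampling mu t n X.
Local Open Scope ereal_scope.

Definition atom (A : {fset S}) : R := fine (mu [set [set` A]]).

Lemma atomE A : (atom A)%:E = mu [set [set` A]].
Proof.
by rewrite fineK// fin_num_measure//; exact: measurable_singleton.
Qed.

Lemma atom_ge0 A : (0 <= atom A)%R.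
Proof. exact: fine_ge0. Qed.

Lemma atom_total : \esum_(A in setT) (atom A)%:E = 1.
Proof.
under eq_esum do rewrite atomE.
rewrite -(@measure_countable_bigcup R _ (powersetType S) mu {fset S} setT
   (fun A => [set [set` A]])); last 2 first.
- by move=> A _; exact: measurable_singleton.
- by move=> A A' _ _ [_ [-> /=]]; exact: (can_inj (@set_fsetK S)).
rewrite -[RHS]hmu; congr (mu _); apply/seteqP; split=> [_ [A _ ->] /=|A /= fA].
  exact: finite_fset.
by exists (fset_set A) => //=; rewrite fset_setK.
Qed.

Lemma atom_bounded A : atom A != 0%R -> (#|` A| <= B)%N.
Proof.
apply: contraR; rewrite -ltnNge => BA; apply/eqP; apply: EFin_inj; rewrite atomE.
apply: hmuB; rewrite /counting asboolT//= set_fsetK.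
by rewrite lte_fin ltr_nat.
Qed.

Definition sampled (x : seq {fset S}) : set T :=
  [set w | n w = size x /\
    forall j, (j < size x)%N -> X j w = [set` nth fset0 x j]].

Lemma measurable_sampled x : measurable (sampled x).
Proof.
rewrite (_ : sampled x = (n @^-1` [set size x]) `&`
   \bigcap_(j in [set j | (j < size x)%N]) (X j @^-1` [set [set` nth fset0 x j]])).
  apply: measurableI; first exact: measurable_funPTI.
  apply: bigcap_measurableType => j _; apply: measurable_funPTI.
  exact: measurable_singleton.
by apply/seteqP; split=> w.
Qed.

Lemma sampled_trivIset (D : set (seq {fset S})) : trivIset D sampled.
Proof.
move=> x y _ _ [w [[nx Xx] [ny Xy]]].
apply: (@eq_from_nth _ fset0); rewrite -nx// => j jx.
by apply: (can_inj (@set_fsetK S)); rewrite -Xx -?nx// -Xy -?ny.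
Qed.

Lemma sampled_prob x : P (sampled x) = (sample_weight atom t x)%:E.
Proof.
have [hn hXj hind] := hX.
pose J := seq_fset tt (None :: map Some (iota 0 (size x))).
pose E (o : option nat) : set T :=
  if o is Some j then X j @^-1` [set [set` nth fset0 x j]]
  else n @^-1` [set size x].
have uJ : uniq (None :: map Some (iota 0 (size x))).
  rewrite /= map_inj_uniq ?iota_uniq ?andbT; last by move=> ? ? [].
  by apply/negP => /mapP [].
have memJ o : (o \in J) = (o \in None :: map Some (iota 0 (size x))).
  by rewrite seq_fsetE.
transitivity (P (\bigcap_(o in [set` J]) E o)).
  congr (P _); apply/seteqP; split=> w.
    move=> [nw Xw] [j|] //=; rewrite memJ inE/= => /mapP[j' + [->]].
    by rewrite mem_iota => /andP[_ jx]; apply: Xw.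
  move=> Ew; split; first by apply: (Ew None); rewrite /= memJ inE.
  move=> j jx; apply: (Ew (Some j)).
  by rewrite /= memJ inE/= map_f// mem_iota.
rewrite hind; last first.
  move=> [j|] _ /=.
    exists [set [set` nth fset0 x j]]; last by rewrite setTI.
    exact: measurable_singleton.
  by exists [set size x]; last by rewrite setTI.
have pJ : perm_eq J (None :: map Some (iota 0 (size x))).
  by apply: perm_trans (seq_fset_perm _ _) _; rewrite undup_id.
rewrite (perm_big _ pJ)/= big_cons big_map /sample_weight EFinM.
congr (_ * _); first by rewrite /E -hn.
rewrite -prodEFin (big_nth fset0) /index_iota subn0; apply: eq_bigr => j _ /=.
rewrite atomE -(hXj j)//; exact: measurable_singleton.
Qed.

(** The weights add up to 1, so almost surely the samples are finite sets. *)
Lemma sampled_cover : P (\bigcup_x sampled x) = 1.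
Proof.
rewrite measure_countable_bigcup; last 2 first.
- by move=> x _; exact: measurable_sampled.
- exact: sampled_trivIset.
rewrite -(sample_mean1 atom_ge0 atom_total t0).
by apply: eq_esum => x _; rewrite mulr1 -sampled_prob.
Qed.

(** Almost surely the sample is one of the countably many finite sequences of
finite sets; outside these events E may be anything. *)
Lemma prob_of_configurations (E : set T) (C : set (seq {fset S})) :
  measurable E -> (forall x w, sampled x w -> (E w <-> C x)) ->
  P E = \esum_(x in C) (sample_weight atom t x)%:E.
Proof.
move=> mE EC; set W := \bigcup_x sampled x.
have mW : measurable W.
  by apply: countable_bigcupT_measurable => // x; exact: measurable_sampled.
have -> : P E = P (E `&` W).
  have nW : P (~` W) = 0 by rewrite probability_setC// sampled_cover subee.
  have -> : P E = P (E `&` W) + P (E `&` ~` W).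
    rewrite -measureU//; try exact: measurableI.
    - by rewrite -setIUr setUv setIT.
    - by apply: measurableI => //; exact: measurableC.
    - by rewrite setIACA setICr setI0.
  suff -> : P (E `&` ~` W) = 0 by rewrite adde0.
  apply/eqP; rewrite eq_le measure_ge0 andbT -nW le_measure ?inE//.
  - by apply: measurableI => //; exact: measurableC.
  - exact: measurableC.
have -> : E `&` W = \bigcup_(x in C) sampled x.
  apply/seteqP; split=> [w [Ew [x _ xw]]|w [x Cx xw]].
    by exists x => //; apply/(EC _ _ xw).
  by split; [apply/(EC _ _ xw)|exists x].
rewrite measure_countable_bigcup; last 2 first.
- by move=> x _; exact: measurable_sampled.
- exact: sampled_trivIset.
by apply: eq_esum => x _; rewrite -sampled_prob.
Qed.

End sampling_law.

(** * Tail bounds for the number of species seen at least i times *)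

Section concentration.
Context (R : realType) (S : countType) (mu : probability (powersetType S) R)
  (B : nat) (t : R) (d : measure_display) (T : measurableType d)
  (P : probability T R) (n : {RV P >-> nat}) (X : nat -> {RV P >-> powersetType S})
  (i : nat).
Hypothesis hmu : supported_on_finite_sets mu.
Hypothesis hB : (1 <= B)%N.
Hypothesis hmuB : size_bounded mu B.
Hypothesis t0 : 0 < t.
Hypothesis hX : poissonized_sampling mu t n X.
Hypothesis i0 : (0 < i)%N.
Local Open Scope ereal_scope.

Lemma occurrencesE (s : S) w :
  occurrences n X s w = (\sum_(j < n w) `[< X j w s >])%N.
Proof.
by rewrite /occurrences -sum1_card big_mkcond/=; apply: eq_bigr.
Qed.

Lemma occurrences_sampled (s : S) x w : sampled n X x w ->
  occurrences n X s w = containing s x.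
Proof.
move=> [nx Xx]; rewrite occurrencesE nx /containing -sum1_count.
rewrite (big_nth fset0) big_mkord [RHS]big_mkcond/=; apply: eq_bigr => j _.
by rewrite Xx//= asboolb; case: (_ \in _).
Qed.

(** On n = m the number of occurrences is a finite sum of indicators. *)
Lemma measurable_seen (s : S) : measurable [set w | (i <= occurrences n X s w)%N].
Proof.
pose E j := X j @^-1` [set A : set S | A s].
have mE j : measurable (E j).
  by apply: measurable_funPTI; exact: measurable_coordinate.
pose f m w : R := (\sum_(j < m) \1_(E j) w)%R.
have mf m : measurable_fun setT (f m).
  by apply: measurable_sum => j; exact: measurable_indic.
rewrite (_ : [set w | _] = \bigcup_m ((n @^-1` [set m]) `&`
    (f m @^-1` `[i%:R, +oo[%classic))); last first.
  have fE m w : f m w = ((\sum_(j < m) `[< X j w s >])%N)%:R.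
    rewrite /f natr_sum; apply: eq_bigr => j _.
    by rewrite indicE; congr (_%:R); congr nat_of_bool; apply/asboolP/asboolP.
  apply/seteqP; split=> w /=.
    move=> iw; exists (n w) => //; split=> //=.
    by rewrite in_itv/= andbT fE ler_nat -occurrencesE.
  by move=> [m _ [/= <-]]; rewrite in_itv/= andbT fE ler_nat -occurrencesE.
apply: bigcup_measurable => m _; apply: measurableI.
  exact: measurable_funPTI.
by rewrite -[X in measurable X]setTI; apply: mf.
Qed.

Definition seen_among (F : seq S) (w : T) : nat :=
  count (fun s => i <= occurrences n X s w)%N F.

Lemma seen_among_sampled F x w : sampled n X x w ->
  seen_among F w = seen_in i F x.
Proof. by move=> xw; apply: eq_count => s; rewrite (occurrences_sampled s xw). Qed.

Lemma measurable_seen_among F :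
  measurable_fun setT (fun w => (seen_among F w)%:R : R).
Proof.
rewrite (_ : (fun _ => _) = fun w =>
    \sum_(s <- F) \1_([set w | (i <= occurrences n X s w)%N]) w)%R.
  by apply: measurable_sum => s; apply: measurable_indic; exact: measurable_seen.
apply/funext => w; rewrite /seen_among -sum1_count big_mkcond natr_sum.
apply: eq_bigr => s _; rewrite indicE; case: ifPn => h.
  by rewrite mem_set.
by rewrite memNset//; apply/negP.
Qed.

Local Notation p := (seen_prob (atom mu) t i).
Local Notation c := ((B%:R - 1) * i%:R + 1 : R)%R.

Lemma prob_seen s : P [set w | (i <= occurrences n X s w)%N] = (p s)%:E.
Proof.
rewrite (@prob_of_configurations _ _ _ _ _ _ P n X hmu t0 hX _
  [set x | (i <= containing s x)%N]) //; last 2 first.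
- exact: measurable_seen.
- by move=> x w xw /=; rewrite (occurrences_sampled s xw).
rewrite seen_probE//; [|exact: atom_ge0|exact: atom_total].
rewrite esum_mkcond; apply: eq_esum => x _; case: ifPn.
  by rewrite inE/= => ->; rewrite mulr1.
by rewrite notin_setE/= => /negP/negbTE ->; rewrite mulr0.
Qed.

Lemma measurable_scaled_seen (F : seq S) (theta a : R) :
  measurable [set w | (theta * a <= theta * (seen_among F w)%:R)%R].
Proof.
rewrite (_ : [set _ | _] = (fun w => theta * (seen_among F w)%:R)%R @^-1`
    `[(theta * a)%R, +oo[%classic); last first.
  by apply/seteqP; split=> w /=; rewrite in_itv/= andbT.
rewrite -[X in measurable X]setTI.
have := measurable_funM (measurable_cst theta) (measurable_seen_among F).
by apply.
Qed.

(** The sign of theta selects the tail: the event bounds the statistic from below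
by a for theta > 0 and from above for theta < 0. *)
Lemma chernoff_finite (F : seq S) (theta a : R) : uniq F ->
  P [set w | (theta * a <= theta * (seen_among F w)%:R)%R] <=
  (expR ((\sum_(s <- F) p s) * ((expR (c * theta) - 1) / c) - theta * a))%:E.
Proof.
move=> uF.
rewrite (@prob_of_configurations _ _ _ _ _ _ P n X hmu t0 hX _
  [set x | (theta * a <= theta * (seen_in i F x)%:R)%R]) //; last 2 first.
- exact: measurable_scaled_seen.
- by move=> x w xw /=; rewrite (seen_among_sampled F xw).
have mgf := species_mgf_le (@atom_ge0 _ _ mu) (atom_total hmu) t0
  (atom_bounded hmuB) hB i0 theta uF.
rewrite addrC expRD EFinM.
apply: le_trans (lee_wpmul2l _ mgf); last by rewrite lee_fin expR_ge0.
rewrite -sample_meanZ ?expR_ge0//; last exact: atom_ge0.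
rewrite esum_mkcond; apply: le_esum => x _; case: ifPn => [|_].
  rewrite inE/= => ax; rewrite lee_fin ler_peMr//.
    by apply: sample_weight_ge0; exact: atom_ge0.
  by rewrite -expRD -[leLHS]expR0 ler_expR [leRHS]addrC subr_ge0.
rewrite lee_fin; apply: mulr_ge0; last by rewrite mulr_ge0 ?expR_ge0.
by apply: sample_weight_ge0; exact: atom_ge0.
Qed.

(** Species of code less than K, so that sums over these lists are partial sums
of a series over nat. *)
Definition first_species (K : nat) : seq S := pmap pickle_inv (iota 0 K).

Lemma first_species_uniq K : uniq (first_species K).
Proof. by apply: pmap_uniq (iota_uniq _ _); exact: pickle_invK. Qed.

Lemma first_species_sum (f : S -> R) K :
  (\sum_(s <- first_species K) f s =
   \sum_(0 <= k < K) oapp f 0 (pickle_inv k))%R.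
Proof. by rewrite big_pmap /index_iota subn0. Qed.

Local Notation S_ := (seen_at_least n X R i).
Local Notation M_ K := (\sum_(s <- first_species K) p s)%R.
Local Notation M := (fine (\int[P]_w S_ w)).

(** By monotone convergence the expectation is the sum over all species of the
probabilities of being seen at least i times, and its partial sums are bounded
by t B. *)
Lemma mean_seen_cvg : \int[P]_w S_ w \is a fin_num /\ (fun K => M_ K) @ \oo --> M.
Proof.
have p0 k : 0 <= (oapp p 0%R (pickle_inv k))%:E.
  by case: (pickle_inv k) => //= s; rewrite lee_fin seen_prob_ge0// => A; exact: atom_ge0.
have ESE : \int[P]_w S_ w = \sum_(0 <= k <oo) (oapp p 0%R (pickle_inv k))%:E.
  pose g (k : nat) (w : T) : \bar R :=
    oapp (fun s => (\1_([set w | (i <= occurrences n X s w)%N]) w)%:E) 0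
      (pickle_inv k).
  transitivity (\int[P]_w (\sum_(0 <= k <oo) g k w)).
    apply: eq_integral => w _; rewrite /seen_at_least counting_esum esum_mkcond.
    rewrite esum_pickle; last by move=> s; case: ifP.
    apply: eq_eseriesr => k _; rewrite /g; case: (pickle_inv k) => //= s.
    rewrite indicE; case: ifPn => [/set_mem h|]; first by rewrite mem_set.
    by rewrite notin_setE => h; rewrite memNset.
  rewrite integral_nneseries//; last 2 first.
  - move=> k; rewrite /g; case: (pickle_inv k) => [s|] /=; last exact: measurable_cst.
    by apply/measurable_EFinP/measurable_indic; exact: measurable_seen.
  - by move=> k w _; rewrite /g; case: (pickle_inv k) => //= s; rewrite lee_fin.
  apply: eq_eseriesr => k _; rewrite /g; case: (pickle_inv k) => /= [s|].
    rewrite integral_indic ?setIT//; first exact: prob_seen.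
    exact: measurable_seen.
  exact: integral0.
have cvgE : (fun K => (M_ K)%:E) @ \oo --> \int[P]_w S_ w.
  rewrite ESE.
  rewrite (_ : (fun _ => _) = fun K => \sum_(0 <= k < K) (oapp p 0%R (pickle_inv k))%:E).
    by apply: is_cvg_nneseries.
  by apply/funext => K; rewrite first_species_sum sumEFin.
have fin : \int[P]_w S_ w \is a fin_num.
  rewrite ge0_fin_numE; last by rewrite ESE nneseries_ge0.
  apply: (@le_lt_trans _ _ (t * B%:R)%:E); last by rewrite ltry.
  rewrite -(cvg_lim _ cvgE)//; apply: lime_le; first by apply/cvg_ex; eexists; exact: cvgE.
  apply: nearW => K; rewrite lee_fin.
  apply: (seen_prob_sum_le (@atom_ge0 _ _ mu) (atom_total hmu) t0
    (atom_bounded hmuB) i0); exact: first_species_uniq.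
split => //; apply: (@fine_cvg _ _ _ _ (fun K => (M_ K)%:E)).
by rewrite fineK.
Qed.

Lemma first_species_cat K j : exists F,
  first_species (K + j) = first_species K ++ F.
Proof.
exists (pmap pickle_inv (iota K j)).
by rewrite /first_species iotaD pmap_cat.
Qed.

Lemma mean_partial_le K : (M_ K <= M)%R.
Proof.
have [_ cvgM] := mean_seen_cvg; rewrite -(cvg_lim _ cvgM)//.
apply: nondecreasing_cvgn_le; last exact: cvgP cvgM.
move=> k l /subnKC <-; have [F ->] := first_species_cat k (l - k).
rewrite big_cat lerDl sumr_ge0// => s _; apply: seen_prob_ge0 => A.
exact: atom_ge0.
Qed.

Lemma seen_among_nondecreasing w k l : (k <= l)%N ->
  (seen_among (first_species k) w <= seen_among (first_species l) w)%N.
Proof.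
move=> /subnKC <-; have [F ->] := first_species_cat k (l - k).
by rewrite /seen_among count_cat leq_addr.
Qed.

Lemma seen_among_le K w : (seen_among (first_species K) w)%:R%:E <= S_ w :> \bar R.
Proof.
rewrite /seen_at_least counting_esum.
pose F := [seq s <- first_species K | (i <= occurrences n X s w)%N].
have uF : uniq F by rewrite filter_uniq// first_species_uniq.
have [J JF pJ] : exists2 J : {fset S}, J =i F & perm_eq J F.
  exists (seq_fset tt F) => [s|]; first by rewrite seq_fsetE.
  by rewrite (perm_trans (seq_fset_perm _ _))// undup_id.
apply: esum_ge; exists [set` J].
  split; first exact: finite_fset.
  by move=> s /=; rewrite JF mem_filter => /andP[].
rewrite fsbig_finite//= set_fsetK (perm_big _ pJ).
by rewrite sumEFin lee_fin /seen_among -size_filter -sum1_size natr_sum.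
Qed.

(** The counts are integers or infinite, so every real level that the total count
reaches is already reached by finitely many species, without passing to a
limit. *)
Lemma seen_among_exhaust w (a : R) :
  a%:E <= S_ w -> exists K, (a <= (seen_among (first_species K) w)%:R)%R.
Proof.
move=> aS; set A := [set s | (i <= occurrences n X s w)%N].
have [F FA aF] : exists2 F : {fset S}, [set` F] `<=` A & (a <= (#|` F|)%:R)%R.
  have [finA|infA] := pselect (finite_set A).
    exists (fset_set A); first by rewrite fset_setK.
    by move: aS; rewrite /seen_at_least /counting asboolT.
  have [F FA aF] := infinite_set_fset (Num.bound `|a|) infA.
  exists F => //; apply: le_trans (ler_norm a) _; apply: ltW.
  by rewrite (lt_le_trans (archi_boundP _))// ler_nat.
exists (\max_(s <- F) choice.pickle s).+1; apply: (le_trans aF).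
rewrite ler_nat /seen_among -size_filter; apply: uniq_leq_size => // s sF.
rewrite mem_filter; apply/andP; split; first exact: FA.
rewrite mem_pmap; apply/mapP; exists (choice.pickle s); last by rewrite pickleK_inv.
by rewrite mem_iota add0n ltnS; exact: leq_bigmax_seq.
Qed.

Lemma c_ge1 : (1 <= c)%R.
Proof. by rewrite lerDr mulr_ge0// subr_ge0 ler1n. Qed.

Lemma scale_event (theta a : R) F : (0 < theta)%R ->
  [set w | (a <= (seen_among F w)%:R)%R] =
  [set w | (theta * a <= theta * (seen_among F w)%:R)%R].
Proof. by move=> th0; apply/seteqP; split=> w /=; rewrite ler_pM2l. Qed.

Lemma measurable_seen_ge F (a : R) :
  measurable [set w | (a <= (seen_among F w)%:R)%R].
Proof. by rewrite (scale_event _ _ ltr01); exact: measurable_scaled_seen. Qed.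

Lemma seen_ge_bigcup (a : R) : [set w | a%:E <= S_ w] =
  \bigcup_K [set w | (a <= (seen_among (first_species K) w)%:R)%R].
Proof.
apply/seteqP; split=> w /=; first by move=> /seen_among_exhaust[K aK]; exists K.
by move=> [K _ aK]; apply: le_trans (seen_among_le K w); rewrite lee_fin.
Qed.

(** The events of the finite lists increase to the event for all species, and
their bounds increase with the partial expectations M_ K. *)
Lemma upper_tail theta a : (0 <= theta)%R ->
  P [set w | a%:E <= S_ w] <=
  (expR (M * ((expR (c * theta) - 1) / c) - theta * a))%:E.
Proof.
rewrite seen_ge_bigcup; set E := fun K => [set w | _].
have mE K : measurable (E K) by exact: measurable_seen_ge.
have mUE : measurable (\bigcup_K E K) by apply: bigcup_measurable.
rewrite le_eqVlt => /predU1P[<-|th0].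
  by rewrite mulr0 expR0 subrr mul0r mulr0 mul0r subr0 expR0 probability_le1.
apply: cvge_to_le (nondecreasing_cvg_mu mE mUE _) _.
  move=> k l kl; apply/subsetPset => w /= /le_trans; apply.
  by rewrite ler_nat seen_among_nondecreasing.
apply: nearW => K /=; rewrite /E (scale_event _ _ th0).
apply: le_trans (chernoff_finite theta a (first_species_uniq K)) _.
rewrite lee_fin ler_expR lerD2r ler_wpM2r ?mean_partial_le//.
have c0 : (0 < c)%R by rewrite (lt_le_trans ltr01)// c_ge1.
by rewrite divr_ge0 ?(ltW c0)// subr_ge0 -[leLHS]expR0 ler_expR mulr_ge0// ltW.
Qed.

Lemma measurable_seen_le (a : R) : measurable [set w | S_ w <= a%:E].
Proof.
rewrite (_ : [set w | _] = \bigcap_K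
    [set w | (-1 * a <= -1 * (seen_among (first_species K) w)%:R)%R]).
  apply: bigcap_measurableType => K _.
  exact: measurable_scaled_seen.
apply/seteqP; split=> w /= Sa.
  move=> K _ /=; rewrite !mulN1r lerN2 -lee_fin.
  by apply: le_trans Sa; exact: seen_among_le.
rewrite leNgt; apply/negP => aS.
have [b ab bS] : exists2 b : R, (a < b)%R & b%:E <= S_ w.
  case: (S_ w) aS => [r| |//]; last by exists (a + 1)%R; rewrite ?leey ?ltrDl.
  by rewrite lte_fin => ar; exists r.
have [K bK] := seen_among_exhaust bS.
have := Sa K I; rewrite /= !mulN1r lerN2 => /(lt_le_trans (lt_le_trans ab bK)).
by rewrite ltxx.
Qed.

(** Here the event is contained in that of each finite list, whose bound decreases
to the claimed one only as M_ K tends to M. *)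
Lemma lower_tail theta a : (theta <= 0)%R ->
  P [set w | S_ w <= a%:E] <=
  (expR (M * ((expR (c * theta) - 1) / c) - theta * a))%:E.
Proof.
move=> th0; have mE := measurable_seen_le a; set f := (_ - 1)%R.
have bound K : P [set w | S_ w <= a%:E] <= (expR (M_ K * (f / c) - theta * a))%:E.
  apply: le_trans (chernoff_finite theta a (first_species_uniq K)).
  apply: le_measure; rewrite ?inE//; first exact: measurable_scaled_seen.
  move=> w /= Sa.
  rewrite ler_wnM2l// -lee_fin; apply: le_trans Sa; exact: seen_among_le.
have [_ meancvg] := mean_seen_cvg.
have cvg_bound : (fun K => expR (M_ K * (f / c) - theta * a)) @ \oo -->
    expR (M * (f / c) - theta * a).
  apply: continuous_cvg; first exact: continuous_expR.
  by apply: cvgB; [apply: cvgM => //; exact: cvg_cst|exact: cvg_cst].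
have cvg_boundE : (fun K => (expR (M_ K * (f / c) - theta * a))%:E) @ \oo -->
    (expR (M * (f / c) - theta * a))%:E.
  by apply: cvg_EFin cvg_bound; apply: nearW.
by apply: (cvge_to_ge cvg_boundE); apply: nearW => K; exact: bound.
Qed.

End concentration.

(** Extended-real division by 0 multiplies by +oo, real division by 0 multiplies
by 0; both give 0 when the numerator vanishes. *)
Lemma expeR_quotient {R : realType} (z D : R) : (D = 0 -> z = 0) ->
  expeR (- ((z ^+ 2)%:E / D%:E)) = (expR (- (z ^+ 2 / D)))%:E.
Proof.
move=> Dz; rewrite inver; case: eqP => [/Dz ->|_] //=.
by rewrite expr0n mul0e oppe0 expeR0 mul0r oppr0 expR0.
Qed.

Local Open Scope ereal_scope.

Theorem lemma29 (R : realType) (S : countType)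
    (mu : probability (powersetType S) R) (B : nat) (t : R)
    (d : measure_display) (T : measurableType d) (P : probability T R)
    (n : {RV P >-> nat}) (X : nat -> {RV P >-> powersetType S})
    (i : nat) (z : R)
    (hmu : supported_on_finite_sets mu) (hB : (1 <= B)%N)
    (hmuB : size_bounded mu B) (ht : (0 < t)%R)
    (hX : poissonized_sampling mu t n X) (hi : (1 <= i)%N) (hz : (0 <= z)%R) :
  let S_ := seen_at_least n X R i in
  let ES := \int[P]_w S_ w in
  let c := ((B%:R - 1) * i%:R + 1 : R)%R in
  P [set w | S_ w - ES <= (- z)%:E] <=
    expeR (- ((z ^+ 2)%:E / ((2 * c)%:E * ES)))
  /\
  P [set w | z%:E <= S_ w - ES] <=
    expeR (- ((z ^+ 2)%:E / ((2 * c)%:E * (ES + (z / 3)%:E)))).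
Proof.
move=> S_ ES c.
have c0 : (0 < c)%R by rewrite (lt_le_trans ltr01)// c_ge1.
have S0 w : 0 <= S_ w by rewrite /S_ /seen_at_least counting_esum esum_ge0.
have [ESfin _] := mean_seen_cvg hmu hmuB ht hX hi.
have M0 : (0 <= fine ES)%R by rewrite fine_ge0// integral_ge0.
have ESE : ES = (fine ES)%:E by rewrite fineK.
set M := fine ES in M0 ESE; split.
- rewrite (_ : [set w | _] = [set w | S_ w <= (M - z)%:E]); last first.
    by apply/seteqP; split=> w /=; rewrite ESE leeBlDr// -EFinD addrC.
  (* If M = 0 the bound is exp (- (z ^+ 2 * +oo)): 1 for z = 0 and 0 otherwise. *)
  have [M00|Mn0] := eqVneq M 0%R.
    have [z0|zn0] := eqVneq z 0%R.
      rewrite z0 expr0n mul0e oppe0 expeR0 probability_le1//.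
      exact: measurable_seen_le.
    rewrite (_ : [set w | _] = set0) ?measure0 ?expeR_ge0//.
    rewrite -subset0 => w /= Sz; have := le_trans (S0 w) Sz.
    by rewrite M00 sub0r lee_fin oppr_ge0 leNgt lt0r zn0 hz.
  rewrite ESE -EFinM expeR_quotient; last first.
    by move=> /eqP; rewrite !mulf_eq0 (gt_eqF c0) (negbTE Mn0) pnatr_eq0.
  have Mgt0 : (0 < M)%R by rewrite lt0r Mn0.
  have [theta th0 opt] := poisson_chernoff_lower Mgt0 c0 hz.
  apply: le_trans (lower_tail hmu hB hmuB ht hX hi _ th0) _.
  by rewrite lee_fin ler_expR.
- rewrite (_ : [set w | _] = [set w | (M + z)%:E <= S_ w]); last first.
    by apply/seteqP; split=> w /=; rewrite ESE leeBrDr// -EFinD addrC.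
  rewrite ESE -EFinD -EFinM expeR_quotient; last first.
    move=> /eqP; rewrite !mulf_eq0 (gt_eqF c0) pnatr_eq0/= paddr_eq0 ?divr_ge0//.
    by move=> /andP[_]; rewrite mulf_eq0 invr_eq0 pnatr_eq0 orbF => /eqP.
  have [theta th0 opt] := poisson_chernoff_upper M0 c0 hz.
  apply: le_trans (upper_tail hmu hB hmuB ht hX hi _ th0) _.
  by rewrite lee_fin ler_expR.
Qed.
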